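(* Let $(M,g)$ be either a Riemannian manifold of odd dimension $m\ge3$, or a Lorentzian manifold (signature $(1,q)$) of dimension $m\ge3$. Then $(M,g)$ is conformally spacelike Jordan Osserman if and only if $(M,g)$ is conformally flat, i.e. its Weyl conformal curvature tensor vanishes identically.
   Context: For a pseudo-Riemannian manifold $(M,g)$ of dimension $m\ge3$ with Riemann curvature tensor $R$ (as a 4-tensor), Ricci tensor $\rho(x,y)=\sum_{ij}g^{ij}R(x,e_i,e_j,y)$ and scalar curvature $\tau=\sum_{ij}g^{ij}\rho(e_i,e_j)$, the Weyl conformal curvature tensor is $W(x,y,z,w)=R(x,y,z,w)-\frac1{m-2}\{\rho(x,w)g(y,z)+g(x,w)\rho(y,z)\}+\frac1{m-2}\{\rho(x,z)g(y,w)+g(x,z)\rho(y,w)\}+\frac{\tau}{(m-1)(m-2)}\{g(x,w)g(y,z)-g(x,z)g(y,w)\}$. The Jacobi operator $J_W(x)$ on $T_PM$ is the self-adjoint endomorphism with $g(J_W(x)y,z)=W(y,x,x,z)$. $(M,g)$ is conformally spacelike Jordan Osserman if for every $P\in M$ the Jordan normal form of $J_{W_P}(x)$ is the same for all $x\in T_PM$ with $g_P(x,x)=1$ (it may depend on $P$). *)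

(* Defs.v *)
From HB Require Import structures.
From mathcomp Require Import all_boot all_order all_algebra.
From mathcomp Require Import all_classical all_reals all_analysis.
Set Implicit Arguments. Unset Strict Implicit. Unset Printing Implicit Defensive.
Import Order.TTheory GRing.Theory Num.Theory.
Import numFieldNormedType.Exports.
Local Open Scope classical_set_scope.
Local Open Scope ring_scope.

Notation coord R m := 'rV[R]_m.

Section Geom.
Variables (R : realType) (m : nat).
Local Notation V := (coord R m).

Definition evec (i : 'I_m) : V := delta_mx 0 i.

Definition iter_deriv (vs : seq V) (f : V -> R) : V -> R :=
  foldr (fun v g => fun x => derive g x v) f vs.

Definition smooth_on (U : set V) (f : V -> R) : Prop :=
  forall (vs : seq V) (x : V), U x ->
    (forall v : V, derivable (iter_deriv vs f) x v) /\
    {for x, continuous (iter_deriv vs f)}.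

Definition pd (i : 'I_m) (f : V -> R) : V -> R := fun x => derive f x (evec i).

Definition ginv (G : V -> 'M[R]_m) (x : V) : 'M[R]_m := invmx (G x).

Definition christoffel (G : V -> 'M[R]_m) (k i j : 'I_m) (x : V) : R :=
  2^-1 * \sum_(l < m) ginv G x k l *
     (pd i (fun y => G y j l) x + pd j (fun y => G y i l) x
      - pd l (fun y => G y i j) x).

(** R_{ijk}^l, with R(X,Y) = [nabla_X, nabla_Y] - nabla_[X,Y],
    R(d_i,d_j) d_k = sum_l R_{ijk}^l d_l *)
Definition riem13 (G : V -> 'M[R]_m) (i j k l : 'I_m) (x : V) : R :=
  pd i (christoffel G l j k) x - pd j (christoffel G l i k) x
  + \sum_(n < m) (christoffel G n j k x * christoffel G l i n x
                  - christoffel G n i k x * christoffel G l j n x).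

Definition riem (G : V -> 'M[R]_m) (x : V) (i j k l : 'I_m) : R :=
  \sum_(n < m) riem13 G i j k n x * G x n l.

Definition ricci (G : V -> 'M[R]_m) (x : V) (a b : 'I_m) : R :=
  \sum_(i < m) \sum_(j < m) ginv G x i j * riem G x a i j b.

Definition scal (G : V -> 'M[R]_m) (x : V) : R :=
  \sum_(i < m) \sum_(j < m) ginv G x i j * ricci G x i j.

Definition weyl (G : V -> 'M[R]_m) (p : V) (a b c d : 'I_m) : R :=
  let g := G p in let rho := ricci G p in
  riem G p a b c d
  - (m%:R - 2)^-1 * (rho a d * g b c + g a d * rho b c)
  + (m%:R - 2)^-1 * (rho a c * g b d + g a c * rho b d)
  + scal G p / ((m%:R - 1) * (m%:R - 2)) * (g a d * g b c - g a c * g b d).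

Definition weyl4 (G : V -> 'M[R]_m) (p : V) (x y z w : V) : R :=
  \sum_(a < m) \sum_(b < m) \sum_(c < m) \sum_(d < m)
    x 0 a * y 0 b * z 0 c * w 0 d * weyl G p a b c d.

Definition gform (Gp : 'M[R]_m) (x y : V) : R := (x *m Gp *m y^T) 0 0.

(** Matrix (acting on row vectors, y |-> y *m J) of the Jacobi operator
    J_W(x): g(J_W(x) y, z) = W(y,x,x,z). *)
Definition jacobiW (G : V -> 'M[R]_m) (p : V) (x : V) : 'M[R]_m :=
  (\matrix_(k, l) weyl4 G p (evec k) x x (evec l)) *m invmx (G p).

(** same Jordan normal form = similar matrices *)
Definition similar (A B : 'M[R]_m) : Prop :=
  exists P : 'M[R]_m, P \in unitmx /\ B = invmx P *m A *m P.

Definition has_signature (p : nat) (Gp : 'M[R]_m) : Prop :=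
  exists S : 'M[R]_m, S \in unitmx /\
    S *m Gp *m S^T = diag_mx (\row_(i < m) (if (i < p)%N then -1 else 1)).

Definition jacobian (tau : V -> V) (x : V) : 'M[R]_m :=
  \matrix_(a, b) pd a (fun y => tau y 0 b) x.

End Geom.

Record chart (R : realType) (m : nat) (M : Type) := Chart {
  cdom : set M;
  cmap : M -> coord R m;
  cmetric : coord R m -> 'M[R]_m }.

Definition pseudo_riemannian (R : realType) (m : nat) (M I : Type)
    (A : I -> chart R m M) (p : nat) : Prop :=
  (forall P : M, exists i, cdom (A i) P) /\
  (forall i, forall P Q, cdom (A i) P -> cdom (A i) Q ->
       cmap (A i) P = cmap (A i) Q -> P = Q) /\
  (forall i j, open (cmap (A i) @` (cdom (A i) `&` cdom (A j)))) /\
  (forall i j, exists tau : coord R m -> coord R m,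
      (forall P, cdom (A i) P -> cdom (A j) P -> tau (cmap (A i) P) = cmap (A j) P)
      /\ (forall b : 'I_m, smooth_on (cmap (A i) @` (cdom (A i) `&` cdom (A j)))
                                     (fun y => tau y 0 b))
      /\ (forall P, cdom (A i) P -> cdom (A j) P ->
            cmetric (A i) (cmap (A i) P) =
            jacobian tau (cmap (A i) P) *m cmetric (A j) (cmap (A j) P)
              *m (jacobian tau (cmap (A i) P))^T)) /\
  (forall i, forall a b : 'I_m,
      smooth_on (cmap (A i) @` cdom (A i)) (fun y => cmetric (A i) y a b)) /\
  (forall i P, cdom (A i) P ->
      (cmetric (A i) (cmap (A i) P))^T = cmetric (A i) (cmap (A i) P) /\
      has_signature p (cmetric (A i) (cmap (A i) P))).

Definition conf_spacelike_jordan_osserman (R : realType) (m : nat) (M I : Type)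
    (A : I -> chart R m M) : Prop :=
  forall i P, cdom (A i) P ->
    let G := cmetric (A i) in let p := cmap (A i) P in
    forall x y : coord R m, gform (G p) x x = 1 -> gform (G p) y y = 1 ->
      similar (jacobiW G p x) (jacobiW G p y).

Definition conformally_flat (R : realType) (m : nat) (M I : Type)
    (A : I -> chart R m M) : Prop :=
  forall i P, cdom (A i) P ->
    forall a b c d : 'I_m, weyl (cmetric (A i)) (cmap (A i) P) a b c d = 0.

(* Main.v *)
Require Import Defs.
From HB Require Import structures.
From mathcomp Require Import all_boot all_order all_algebra.
From mathcomp Require Import all_classical all_reals all_analysis.
From mathcomp Require Import perm fingroup ring lra.
From mathcomp Require mpoly.
Import -(notations) mpoly.
Set Implicit Arguments. Unset Strict Implicit. Unset Printing Implicit Defensive.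
Import Order.TTheory GRing.Theory Num.Theory.
Import numFieldNormedType.Exports.
Local Open Scope classical_set_scope.
Local Open Scope ring_scope.

(** The Weyl tensor is an algebraic curvature tensor without trace. Write [J x]
    for its Jacobi operator; all [J x] with [g(x,x) = 1] are similar.

    Lorentzian case: [tr (J x ^ 2)] is a constant times [g(x,x)^2] for spacelike
    [x], hence it vanishes for null [u]. As [J u] induces a symmetric operator on
    the Euclidean space [u^perp / u], it is zero there. Taking [u = e + a] with
    [e] timelike and [a] a unit vector orthogonal to it makes [J e] a multiple of
    the identity on [e^perp], so [J e = 0] by tracelessness, and [J = 0] since
    timelike vectors form an open cone.

    Riemannian case, odd dimension: a nonzero [J] has an eigenvalue [l <> 0], the
    same for all unit [x], and the projections onto the [l]-eigenspaces are
    polynomial in [x]. So the tangent bundle of an even-dimensional sphere splits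
    as [E + F], both summands being proper since the trace is zero. Transporting
    a vector from one pole in [E] and from the opposite pole in [F] gives
    polynomial sections with no common zero; their sum is a nowhere vanishing
    tangent field, contradicting the hairy ball theorem. The latter is proved for
    polynomial fields [v] on the boundary of a cube: for the homotopy
    [H(t,x) = - t x + (1 - t^2) v(x)] from [x] to [-x], and [psi] a bump function
    at the origin, [psi(H)] times the minors of [DH] is a divergence free field
    (Piola identity) whose flux through the two time faces would have a strict
    sign; its discrete flux on a fine grid shows that this is impossible. *)

(** * Piola identity *)

(** Iterated Leibniz rule. Uniqueness of [s] matters because the inner product drops the index [i]
    wherever it occurs. *)
Lemma derivation_prod (A : comNzRingType) (D : {additive A -> A}) (I : eqType)
    (s : seq I) (F : I -> A) :
  (forall x y, D (x * y) = D x * y + x * D y) -> uniq s ->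
  D (\prod_(k <- s) F k) = \sum_(i <- s) D (F i) * \prod_(k <- s | k != i) F k.
Proof.
move=> DM; elim: s => [|a s IHs] /=.
  (* The empty product asks for [D 1 = 0], which follows from [D (1 * 1) = D 1 + D 1]. *)
  move=> _; rewrite !big_nil; apply: (addrI (D 1)).
  by rewrite addr0 -{3}[1]mulr1 DM mulr1 mul1r.
move=> /andP[as_ us]; rewrite !big_cons DM IHs// eqxx /=.
congr (_ * _ + _).
  rewrite -[RHS]big_filter; congr (\prod_(k <- _) F k).
  symmetry; apply/all_filterP/allP => k ks.
  by apply: contraNneq as_ => <-.
rewrite mulr_sumr; apply: eq_big_seq => i is_; rewrite big_cons.
rewrite ifT; first by rewrite mulrCA.
by apply: contraNneq as_ => ->.
Qed.

(* The s- and (tperm 0 r * s)-terms of the Leibniz expansion cancel, because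
   the derivations commute. *)
Lemma piola (A : comNzRingType) n (D : 'I_n.+1 -> {additive A -> A})
    (G : 'I_n.+1 -> A) (DG : 'M[A]_n.+1) :
  (forall j x y, D j (x * y) = D j x * y + x * D j y) ->
  (forall i j x, D i (D j x) = D j (D i x)) ->
  (forall i j, i != ord0 -> DG i j = D j (G i)) ->
  \sum_j D j (cofactor DG ord0 j) = 0.
Proof.
move=> DM DC DGE.
(* [T r s] is the part of the [s]-term, without its sign, in which the outer derivation hits the
   factor of row [r]. *)
pose T (r : 'I_n.+1) (s : 'S_n.+1) : A :=
  D (s ord0) (D (s r) (G r)) * \prod_(k | (ord0 != k) && (k != r)) D (s k) (G k).
have E : \sum_j D j (cofactor DG ord0 j) =
    \sum_(s : 'S_n.+1) \sum_(r | ord0 != r) (-1) ^+ s * T r s.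
  rewrite [RHS](partition_big (fun s : 'S_n.+1 => s ord0) xpredT) //=.
  apply: eq_bigr => j _; rewrite expand_cofactor raddf_sum /=.
  apply: eq_bigr => s /eqP sj.
  have -> : \prod_(k | ord0 != k) DG k (s k) = \prod_(k | ord0 != k) D (s k) (G k).
    by apply: eq_bigr => k k0; rewrite DGE// eq_sym.
  have -> x : D j ((-1) ^+ s * x) = (-1) ^+ s * D j x.
    by rewrite -signr_odd; case: (odd _); rewrite ?expr1 ?expr0 ?mul1r // !mulN1r raddfN.
  rewrite -big_filter derivation_prod ?filter_uniq ?index_enum_uniq//.
  rewrite big_filter mulr_sumr; apply: eq_bigr => r r0.
  congr (_ * _); rewrite /T sj big_filter_cond; congr (_ * _).
rewrite E exchange_big /=; apply: big1 => r r0.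
(* For fixed [r], composing with [tperm ord0 r] pairs the even permutations with the odd ones. *)
rewrite (bigID (@odd_perm _)) /= addrC.
rewrite (reindex_inj (mulgI (tperm ord0 r))) /=.
rewrite (eq_bigl (@odd_perm _)) => [|s]; last first.
  by rewrite odd_permM odd_tperm r0 negbK.
rewrite -big_split /= big1// => s sodd.
rewrite odd_permM odd_tperm r0 sodd /= expr0 expr1 mul1r mulN1r.
suff -> : T r (tperm ord0 r * s)%g = T r s by rewrite subrr.
rewrite /T !permM tpermL tpermR DC; congr (_ * _).
apply: eq_bigr => k /andP[k0 kr]; rewrite permM tpermD// eq_sym//.
Qed.

(** * Polynomial functions *)

Section PolynomialFunctions.
Variable R : realType.

(** The properties proved below are stable under sums and products, so it suffices to check the ring
    generators. *)
Lemma mpoly_gen_ind n (P : mpoly n R -> Prop) :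
  (forall c, P (mpolyC n c)) -> (forall i, P (mpolyX R (mnm1 i))) ->
  (forall p q, P p -> P q -> P (p + q)) ->
  (forall p q, P p -> P q -> P (p * q)) -> forall p, P p.
Proof.
move=> PC PX PD PM; elim/mpolyind => [|c m p _ _ Pp].
  by rewrite -[0](mpolyC0 n R); exact: PC.
apply: (PD) => //; rewrite -mul_mpolyC; apply: (PM) => //.
have P1 : P 1 by rewrite -(mpolyC1 n R); exact: PC.
rewrite mpolyXE_id; apply: (big_ind P P1 PM) => i _.
elim: (m i) => [|k IHk]; first by rewrite expr0.
by rewrite exprS; exact: PM.
Qed.

(** The witness stays hidden so that functions compose freely; it is opened where formal derivatives
    are wanted. *)
Definition polyf n (f : 'rV[R]_n -> R) : Prop :=
  exists p : mpoly n R, forall x, f x = meval (x 0) p.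

Lemma polyf_meval n (p : mpoly n R) : polyf (fun x => meval (x 0) p).
Proof. by exists p. Qed.

Lemma polyf_ext n (f g : 'rV[R]_n -> R) : f =1 g -> polyf f -> polyf g.
Proof. by move=> fg [p pE]; exists p => x; rewrite -fg. Qed.

Lemma polyf_cst n c : polyf (fun _ : 'rV[R]_n => c).
Proof. by exists (mpolyC n c) => x; rewrite mevalC. Qed.

Lemma polyf_coord n i : polyf (fun x : 'rV[R]_n => x 0 i).
Proof. by exists (mpolyX R (mnm1 i)) => x; rewrite mevalXU. Qed.

Lemma polyfD n (f g : 'rV[R]_n -> R) :
  polyf f -> polyf g -> polyf (fun x => f x + g x).
Proof. by move=> [p pE] [q qE]; exists (p + q) => x; rewrite mevalD pE qE. Qed.

Lemma polyfM n (f g : 'rV[R]_n -> R) :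
  polyf f -> polyf g -> polyf (fun x => f x * g x).
Proof. by move=> [p pE] [q qE]; exists (p * q) => x; rewrite mevalM pE qE. Qed.

Lemma polyfN n (f : 'rV[R]_n -> R) : polyf f -> polyf (fun x => - f x).
Proof. by move=> [p pE]; exists (- p) => x; rewrite mevalN pE. Qed.

Lemma polyfB n (f g : 'rV[R]_n -> R) :
  polyf f -> polyf g -> polyf (fun x => f x - g x).
Proof. by move=> pf pg; apply: polyfD => //; exact: polyfN. Qed.

Lemma polyfX n (f : 'rV[R]_n -> R) k : polyf f -> polyf (fun x => f x ^+ k).
Proof. by move=> [p pE]; exists (p ^+ k) => x; rewrite rmorphXn /= pE. Qed.

Lemma polyf_sum n (I : Type) (s : seq I) (Q : pred I) (f : I -> 'rV[R]_n -> R) :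
  (forall i, polyf (f i)) -> polyf (fun x => \sum_(i <- s | Q i) f i x).
Proof.
move=> pf; elim: s => [|a s IHs].
  by apply: polyf_ext (polyf_cst n 0) => x; rewrite big_nil.
have [Qa|Qa] := boolP (Q a); last first.
  by apply: polyf_ext IHs => x; rewrite big_cons (negbTE Qa).
apply: polyf_ext (polyfD (pf a) IHs) => x; by rewrite big_cons Qa.
Qed.

Lemma polyf_comp n k (f : 'rV[R]_k -> R) (g : 'rV[R]_n -> 'rV[R]_k) :
  polyf f -> (forall i, polyf (fun x => g x 0 i)) -> polyf (fun x => f (g x)).
Proof.
move=> [p pE] pg; apply: (@polyf_ext _ (fun x => meval (g x 0) p)) => [x|].
  by rewrite pE.
elim/mpoly_gen_ind: p {pE} => [c|i|p q Pp Pq|p q Pp Pq].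
- by apply: polyf_ext (polyf_cst n c) => x; rewrite mevalC.
- by apply: polyf_ext (pg i) => x; rewrite mevalXU.
- by apply: polyf_ext (polyfD Pp Pq) => x; rewrite mevalD.
- by apply: polyf_ext (polyfM Pp Pq) => x; rewrite mevalM.
Qed.

Lemma polyf_mulmx n a b c (f : 'rV[R]_n -> 'M[R]_(a, b))
    (g : 'rV[R]_n -> 'M[R]_(b, c)) :
  (forall i j, polyf (fun x => f x i j)) ->
  (forall i j, polyf (fun x => g x i j)) ->
  forall i j, polyf (fun x => (f x *m g x) i j).
Proof.
move=> pf pg i j.
apply: (@polyf_ext _ (fun x => \sum_k f x i k * g x k j)) => [x|].
  by rewrite mxE.
by apply: polyf_sum => k; apply: polyfM.
Qed.

Lemma polyf_continuous n (f : 'rV[R]_n -> R) : polyf f -> continuous f.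
Proof.
move=> [p pE]; have -> : f = fun x => meval (x 0) p by apply/funext.
elim/mpoly_gen_ind: p {pE} => [c|i|p q Pp Pq|p q Pp Pq] x.
- have -> : (fun x : 'rV[R]_n => meval (x 0) (mpolyC n c)) = fun=> c.
    by apply/funext => y; rewrite mevalC.
  exact: cst_continuous.
- have -> : (fun x : 'rV[R]_n => meval (x 0) (mpolyX R (mnm1 i))) = fun x => x 0 i.
    by apply/funext => y; rewrite mevalXU.
  exact: coord_continuous.
- have -> : (fun x : 'rV[R]_n => meval (x 0) (p + q)) =
     (fun x => meval (x 0) p) + (fun x => meval (x 0) q).
    by apply/funext => y; rewrite mevalD.
  by apply: continuousD; [exact: Pp|exact: Pq].
- have -> : (fun x : 'rV[R]_n => meval (x 0) (p * q)) =
     (fun x => meval (x 0) p) * (fun x => meval (x 0) q).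
    by apply/funext => y; rewrite mevalM.
  by apply: continuousM; [exact: Pp|exact: Pq].
Qed.

Definition box n (B : R) (x : 'rV[R]_n) := forall i, `|x 0 i| <= B.

(** First-order expansion along the coordinate axes with a quadratic remainder, uniform on the box.
    Only the base point has to lie in the box. The bounds on [f] and [df] are included to make the
    notion stable under products. *)
Definition taylor n (B : R) (f : 'rV[R]_n -> R) (df : 'I_n -> 'rV[R]_n -> R) :=
  exists2 C, 0 <= C & forall x j h, box B x -> 0 <= h <= 1 ->
    [/\ `|f x| <= C, `|df j x| <= C
      & `|f (x + h *: delta_mx 0 j) - f x - h * df j x| <= C * h ^+ 2].

Lemma taylorD n B f df g dg : taylor (n := n) B f df -> taylor B g dg ->
  taylor B (fun x => f x + g x) (fun j x => df j x + dg j x).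
Proof.
move=> [C C0 fC] [K K0 gK]; exists (C + K) => [|x j h bx h1]; first exact: addr_ge0.
have [f1 f2 f3] := fC x j h bx h1; have [g1 g2 g3] := gK x j h bx h1.
split; [exact: le_trans (ler_normD _ _) (lerD _ _)..|].
rewrite mulrDl; apply: le_trans (lerD f3 g3); apply: le_trans (ler_normD _ _).
by rewrite le_eqVlt; apply/orP; left; apply/eqP; congr `|_|; ring.
Qed.

Lemma taylorM n B f df g dg : taylor (n := n) B f df -> taylor B g dg ->
  taylor B (fun x => f x * g x) (fun j x => df j x * g x + f x * dg j x).
Proof.
move=> [C C0 fC] [K K0 gK]; exists (6 * (C * K)).
  by rewrite !mulr_ge0.
move=> x j h bx h1.
have [f1 f2 f3] := fC x j h bx h1; have [g1 g2 g3] := gK x j h bx h1.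
have CK0 := mulr_ge0 C0 K0; have /andP[h0 hle1] := h1.
split.
- rewrite normrM; apply: (@le_trans _ _ (C * K)); first exact: ler_pM.
  by lra.
- apply: le_trans (ler_normD _ _) _; rewrite !normrM.
  have a1 := ler_pM (normr_ge0 _) (normr_ge0 _) f2 g1.
  have a2 := ler_pM (normr_ge0 _) (normr_ge0 _) f1 g2.
  by lra.
set F := f (x + _) in f3 *; set G := g (x + _) in g3 *.
set a := F - f x - _ in f3; set b := G - g x - _ in g3.
(* The three summands are bounded by 1, 2 and 3 times [C * K * h ^+ 2], whence the constant 6. *)
have -> : F * G - f x * g x - h * (df j x * g x + f x * dg j x) =
    h ^+ 2 * (df j x * dg j x) + b * (f x + h * df j x)
    + a * (g x + h * dg j x + b) by rewrite /a /b; ring.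
have h2 : 0 <= h ^+ 2 <= 1 by rewrite sqr_ge0 exprn_ile1.
have /andP[h20 h21] := h2.
have u1 : `|h ^+ 2 * (df j x * dg j x)| <= h ^+ 2 * (C * K).
  by rewrite normrM ger0_norm// normrM; apply: ler_wpM2l => //; exact: ler_pM.
have u2 : `|f x + h * df j x| <= 2 * C.
  apply: le_trans (ler_normD _ _) _; rewrite normrM (ger0_norm h0).
  have := ler_pM h0 (normr_ge0 _) hle1 f2; rewrite mul1r; lra.
have u3 : `|g x + h * dg j x + b| <= 3 * K.
  apply: le_trans (ler_normD _ _) _.
  have : `|g x + h * dg j x| <= 2 * K.
    apply: le_trans (ler_normD _ _) _; rewrite normrM (ger0_norm h0).
    have := ler_pM h0 (normr_ge0 _) hle1 g2; rewrite mul1r; lra.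
  have : K * h ^+ 2 <= K by rewrite -[leRHS]mulr1; exact: ler_wpM2l.
  lra.
have v2 := ler_pM (normr_ge0 _) (normr_ge0 _) g3 u2.
have v3 := ler_pM (normr_ge0 _) (normr_ge0 _) f3 u3.
apply: le_trans (ler_normD _ _) _; apply: le_trans (lerD (ler_normD _ _) (lexx _)) _.
rewrite (normrM b) (normrM a).
apply: le_trans (lerD (lerD u1 v2) v3) _.
by rewrite le_eqVlt; apply/orP; left; apply/eqP; ring.
Qed.

Lemma taylor_meval n B (p : mpoly n R) : 0 <= B ->
  taylor B (fun x => meval (x 0) p) (fun j x => meval (x 0) (mderiv j p)).
Proof.
move=> B0; elim/mpoly_gen_ind: p => [c|i|p q Pp Pq|p q Pp Pq].
- exists `|c| => // x j h bx h1; rewrite mderivC !mevalC normr0 mulr0 subr0 subrr normr0.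
  by split => //; rewrite mulr_ge0// sqr_ge0.
- exists (B + 1) => [|x j h bx h1]; first by rewrite addr_ge0.
  have -> : mderiv j (mpolyX R (mnm1 i)) = mpolyC n (i == j)%:R.
    rewrite mderivX mnm1E; case: eqP => [->|_]; last by rewrite scale0r mpolyC0.
    rewrite scale1r (_ : mnm_sub _ _ = mnm0) ?mpolyX0 ?mpolyC1//.
    by apply/mnmP => k; rewrite mnmBE subnn mnm0E.
  rewrite !mevalXU mevalC !mxE /= eq_sym; split.
  + by apply: le_trans (bx i) _; lra.
  + by case: eqP => _; rewrite ?normr1 ?normr0; lra.
  + rewrite [X in `|X|](_ : _ = 0) ?normr0; last by ring.
    by rewrite mulr_ge0 ?sqr_ge0// addr_ge0.
- have := taylorD Pp Pq; congr (taylor B _ _).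
    by apply/funext => x; rewrite mevalD.
  by apply/funext => j; apply/funext => x; rewrite mderivD mevalD.
- have := taylorM Pp Pq; congr (taylor B _ _).
    by apply/funext => x; rewrite mevalM.
  by apply/funext => j; apply/funext => x; rewrite mderivM mevalD !mevalM.
Qed.

(** Squaring makes the positive part differentiable with Lipschitz derivative, so the remainder
    stays quadratic. This provides the bump function at the origin. *)
Lemma taylor_sqr_pos n B f df : taylor (n := n) B f df ->
  taylor B (fun x => Num.max (f x) 0 ^+ 2) (fun j x => 2 * Num.max (f x) 0 * df j x).
Proof.
move=> [C C0 fC]; exists (6 * (C * C)) => [|x j h bx h1]; first by rewrite !mulr_ge0.
have [f1 f2 f3] := fC x j h bx h1; have /andP[h0 hle1] := h1.
have CC := mulr_ge0 C0 C0.
have h20 := sqr_ge0 h.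
set a := f x in f1 f3 *; set b := f (x + _) in f3 *; set d := df j x in f2 f3 *.
have m0 : 0 <= Num.max a 0 by rewrite le_max lexx orbT.
have mC : Num.max a 0 <= C by rewrite ge_max C0 (le_trans (ler_norm _)).
(* Expansion of the outer function alone. As [b - a] is at most [2 * C * h], it contributes 4 to the
   constant 6; the error of [f] itself contributes 2. *)
have key : `|Num.max b 0 ^+ 2 - Num.max a 0 ^+ 2 - 2 * Num.max a 0 * (b - a)|
    <= (b - a) ^+ 2.
  have sa := sqr_ge0 a; have sb := sqr_ge0 b; have sab := sqr_ge0 (b - a).
  case: (lerP b 0) => b0; case: (lerP a 0) => a0.
  - by rewrite expr0n /= mulr0 mul0r !subr0 normr0.
  - have := mulr_ge0_le0 (ltW a0) b0.
    by rewrite expr0n /= ler_norml => ab0; apply/andP; split; nra.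
  - have := mulr_ge0_le0 (ltW b0) a0.
    by rewrite expr0n /= ler_norml => ab0; apply/andP; split; nra.
  - by rewrite ler_norml; apply/andP; split; nra.
have w1 : `|b - a| <= 2 * C * h.
  have -> : b - a = (b - a - h * d) + h * d by ring.
  apply: le_trans (ler_normD _ _) _; rewrite (normrM h) (ger0_norm h0).
  have : C * h ^+ 2 <= C * h by rewrite ler_wpM2l// expr2 ler_piMl.
  have := ler_wpM2l h0 f2; lra.
have w2 : (b - a) ^+ 2 <= 4 * (C * C) * h ^+ 2.
  rewrite -real_normK ?num_real//.
  apply: le_trans (_ : (2 * C * h) ^+ 2 <= _); first by rewrite !expr2 ler_pM.
  by rewrite le_eqVlt; apply/orP; left; apply/eqP; ring.
have w3 : `|2 * Num.max a 0 * (b - a - h * d)| <= 2 * C * (C * h ^+ 2).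
  rewrite normrM; apply: ler_pM => //; rewrite ger0_norm; last by rewrite mulr_ge0.
  by rewrite ler_wpM2l.
split.
- rewrite ger0_norm ?sqr_ge0// expr2.
  apply: le_trans (_ : C * C <= _); first exact: ler_pM.
  lra.
- rewrite normrM ger0_norm; last by rewrite mulr_ge0.
  apply: le_trans (_ : 2 * C * C <= _); last lra.
  by apply: ler_pM => //; rewrite ?mulr_ge0// ler_wpM2l.
- have -> : Num.max b 0 ^+ 2 - Num.max a 0 ^+ 2 - h * (2 * Num.max a 0 * d) =
    (Num.max b 0 ^+ 2 - Num.max a 0 ^+ 2 - 2 * Num.max a 0 * (b - a))
    + 2 * Num.max a 0 * (b - a - h * d) by ring.
  apply: le_trans (ler_normD _ _) _.
  apply: le_trans (lerD (le_trans key w2) w3) _.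
  by rewrite le_eqVlt; apply/orP; left; apply/eqP; ring.
Qed.

End PolynomialFunctions.

(** * Hairy ball theorem for polynomial fields *)

Section DiscreteDivergence.
Variable R : realType.

(** Lower corners of the cells of side [2 / N.+1] in the cube: the face at 1 contains no grid point
    and is reached by one step from the last index. *)
Definition gridpt n N (k : {ffun 'I_n -> 'I_N.+1}) : 'rV[R]_n :=
  \row_i (-1 + 2 / N.+1%:R * (k i)%:R).

(* Cyclic in the j-th coordinate, hence a bijection of the grid: sums of
   differences in direction j only see the two faces orthogonal to it. *)
Definition gridshift n N (j : 'I_n) (k : {ffun 'I_n -> 'I_N.+1}) :
  {ffun 'I_n -> 'I_N.+1} := [ffun i => if i == j then ordS (k i) else k i].

Lemma gridshift_inj n N j : injective (@gridshift n N j).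
Proof.
move=> k l /ffunP kl; apply/ffunP => i; have := kl i; rewrite !ffunE.
by case: ifP => // _ /ordS_inj.
Qed.

Lemma gridpt_box n N (k : {ffun 'I_n -> 'I_N.+1}) : box 1 (gridpt k).
Proof.
move=> i; rewrite mxE ler_norml.
have N0 : 0 < N.+1%:R :> R by rewrite ltr0n.
have k0 : 0 <= (k i)%:R :> R by rewrite ler0n.
have kN : (k i)%:R <= N.+1%:R :> R by rewrite ler_nat ltnW.
rewrite mulrAC; have : (0 <= 2 * (k i)%:R / N.+1%:R :> R) && (2 * (k i)%:R / N.+1%:R <= 2 :> R).
  by apply/andP; split; [rewrite divr_ge0 ?mulr_ge0|rewrite ler_pdivrMr// ler_wpM2l].
by move: (_ / _) => X /andP[u1 u2]; apply/andP; split; lra.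
Qed.

Lemma gridpt_shift n N (j : 'I_n) (k : {ffun 'I_n -> 'I_N.+1}) :
  k j != ord_max ->
  gridpt k + (2 / N.+1%:R) *: delta_mx 0 j = gridpt (gridshift j k).
Proof.
move=> kj; apply/rowP => i; rewrite !mxE ffunE /=.
case: eqP => [->|_]; last by rewrite mulr0 addr0.
have kN : (k j < N)%N by rewrite ltn_neqAle -ltnS ltn_ord andbT.
by rewrite /= modn_small// mulr1 -natr1; ring.
Qed.

Lemma gridpt_top n N (j : 'I_n) (k : {ffun 'I_n -> 'I_N.+1}) :
  k j = ord_max -> (gridpt k + (2 / N.+1%:R) *: delta_mx 0 j) 0 j = 1.
Proof.
move=> kj; rewrite !mxE kj !eqxx mulr1 /=.
have N0 : N.+1%:R != 0 :> R by rewrite pnatr_eq0.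
have -> : N%:R = N.+1%:R - 1 :> R by rewrite -natr1 addrK.
by field.
Qed.

Lemma gridpt_bot n N (j : 'I_n) (k : {ffun 'I_n -> 'I_N.+1}) :
  k j = ord_max -> gridpt (gridshift j k) 0 j = -1.
Proof. by move=> kj; rewrite !mxE ffunE eqxx kj /= modnn mulr0 addr0. Qed.

Lemma gridpt_off n N (j i : 'I_n) (k : {ffun 'I_n -> 'I_N.+1}) : i != j ->
  (gridpt k + (2 / N.+1%:R) *: delta_mx 0 j) 0 i = gridpt (gridshift j k) 0 i.
Proof. by move=> ij; rewrite !mxE ffunE (negbTE ij) mulr0 addr0. Qed.

Lemma gridpt_step_box n N (j : 'I_n) (k : {ffun 'I_n -> 'I_N.+1}) :
  box 1 (gridpt k + (2 / N.+1%:R) *: delta_mx 0 j).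
Proof.
have [kj|kj] := eqVneq (k j) ord_max; last first.
  by rewrite gridpt_shift//; exact: gridpt_box.
move=> i; have [->|ij] := eqVneq i j; first by rewrite gridpt_top// normr1.
by rewrite gridpt_off//; exact: gridpt_box.
Qed.

(** Reindexing by the cyclic shift cancels every term outside the last layer, where the shift jumps
    from the face at 1 to the face at -1. *)
Lemma grid_telescope n N (j : 'I_n) (F : 'rV[R]_n -> R) :
  \sum_(k : {ffun 'I_n -> 'I_N.+1})
     (F (gridpt k + (2 / N.+1%:R) *: delta_mx 0 j) - F (gridpt k)) =
  \sum_(k : {ffun 'I_n -> 'I_N.+1} | k j == ord_max)
     (F (gridpt k + (2 / N.+1%:R) *: delta_mx 0 j) - F (gridpt (gridshift j k))).
Proof.
rewrite sumrB [X in _ - X](reindex_inj (@gridshift_inj n N j)) -sumrB.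
rewrite (bigID (fun k : {ffun 'I_n -> 'I_N.+1} => k j == ord_max)) /=.
rewrite [X in _ + X]big1 ?addr0// => k kj.
by rewrite gridpt_shift// subrr.
Qed.

(* Coordinate 0 plays the role of time: the flux of a divergence free field
   through the two time faces of the cube cannot be strictly signed. *)
Lemma no_signed_flux n (F dF : 'I_n.+2 -> 'rV[R]_n.+2 -> R)
    (phi : 'rV[R]_n.+2 -> R) (C c eps : R) :
  0 <= C -> 0 < c -> 0 < eps ->
  (forall j x h, box 1 x -> 0 <= h <= 1 ->
     `|F j (x + h *: delta_mx 0 j) - F j x - h * dF j x| <= C * h ^+ 2) ->
  (forall x, \sum_j dF j x = 0) ->
  (forall j (x : 'rV[R]_n.+2), box 1 x -> j != ord0 -> `|x 0 j| = 1 -> F j x = 0) ->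
  (forall x : 'rV[R]_n.+2, x 0 ord0 = 1 -> F ord0 x = - phi x) ->
  (forall x : 'rV[R]_n.+2, x 0 ord0 = -1 -> F ord0 x = phi x) ->
  (forall x y : 'rV[R]_n.+2, (forall i, i != ord0 -> x 0 i = y 0 i) -> phi x = phi y) ->
  (forall x, 0 <= phi x) ->
  (forall x : 'rV[R]_n.+2, (forall i, i != ord0 -> `|x 0 i| <= eps) -> c <= phi x) ->
  False.
Proof.
move=> C0 c0 eps0 est div0 side top bot phiE phi0 phic.
(* [1 / L] is a width on which [phi] is known to be at least [c]; [r] will count the grid points in
   that width. *)
pose L := (Num.bound eps^-1).+1.
have Leps : L%:R^-1 <= eps.
  rewrite -[eps]invrK lef_pV2 ?posrE ?invr_gt0 ?ltr0n//.
  apply: ltW; apply: lt_le_trans (archi_boundP _) _; first by rewrite invr_ge0 ltW.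
  by rewrite ler_nat.
(* The grid has [2 * r * L] points per direction. The right side is the total remainder: one error
   of order [h ^+ 2] per cell and direction. The left side is a lower bound for the flux through the
   time faces. *)
have flux (r : nat) : (0 < r)%N ->
  2 * c * r%:R ^+ n.+1 <= 4 * n.+2%:R * C * (2 * r%:R * L%:R) ^+ n.
  move=> r0.
  have [N NE] : exists N, N.+1 = (2 * r * L)%N.
    by exists (2 * r * L).-1; rewrite prednK// !muln_gt0 r0.
  have N0 : 0 < N.+1%:R :> R by rewrite ltr0n.
  have Nn0 : N.+1%:R != 0 :> R by rewrite pnatr_eq0.
  have NN : N.+1%:R = 2 * r%:R * L%:R :> R by rewrite NE !natrM.
  pose h : R := 2 / N.+1%:R.
  have h1 : 0 <= h <= 1.
    rewrite divr_ge0//= ler_pdivrMr// mul1r NE ler_nat -mulnA leq_pmulr//.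
    by rewrite muln_gt0 r0.
  have up : `|\sum_j \sum_(k : {ffun 'I_n.+2 -> 'I_N.+1})
      (F j (gridpt k + h *: delta_mx 0 j) - F j (gridpt k))| <=
      4 * n.+2%:R * C * (2 * r%:R * L%:R) ^+ n.
    rewrite exchange_big /=; apply: le_trans (ler_norm_sum _ _ _) _.
    have -> : 4 * n.+2%:R * C * (2 * r%:R * L%:R) ^+ n =
      \sum_(k : {ffun 'I_n.+2 -> 'I_N.+1}) n.+2%:R * (C * h ^+ 2).
      rewrite sumr_const card_ffun !card_ord -[RHS]mulr_natr natrX -NN /h !exprS.
      by field.
    apply: ler_sum => k _.
    have -> : \sum_j (F j (gridpt k + h *: delta_mx 0 j) - F j (gridpt k)) =
       \sum_j (F j (gridpt k + h *: delta_mx 0 j) - F j (gridpt k) - h * dF j (gridpt k)).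
      by rewrite [RHS]sumrB -mulr_sumr div0 mulr0 subr0.
    apply: le_trans (ler_norm_sum _ _ _) _.
    have -> : n.+2%:R * (C * h ^+ 2) = \sum_(j < n.+2) C * h ^+ 2.
      by rewrite sumr_const card_ord mulr_natl.
    by apply: ler_sum => j _; apply: est => //; exact: gridpt_box.
  apply: le_trans up; rewrite ler_normr; apply/orP; right.
  (* Only the time direction survives, since [F j] vanishes on both faces orthogonal to a space
     direction. *)
  rewrite (bigD1 ord0)//= [X in _ + X]big1 ?addr0; last first.
    move=> j j0; rewrite grid_telescope big1// => k /eqP kj.
    rewrite side//; [|exact: gridpt_step_box|by rewrite gridpt_top// normr1].
    rewrite side ?subr0//; first exact: gridpt_box.
    by rewrite gridpt_bot// normrN normr1.
  rewrite grid_telescope -sumrN.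
  have -> : \sum_(k : {ffun 'I_n.+2 -> 'I_N.+1} | k ord0 == ord_max)
      - (F ord0 (gridpt k + 2 / N.+1%:R *: delta_mx 0 ord0)
         - F ord0 (gridpt (gridshift ord0 k))) =
     \sum_(k : {ffun 'I_n.+2 -> 'I_N.+1} | k ord0 == ord_max) 2 * phi (gridpt k).
    apply: eq_bigr => k /eqP kj; rewrite top ?gridpt_top// bot ?gridpt_bot//.
    rewrite (phiE _ (gridpt k)) ?(phiE (gridpt (gridshift ord0 k)) (gridpt k)).
    - by ring.
    - by move=> i i0; rewrite -gridpt_off// !mxE (negbTE i0) mulr0 addr0.
    - by move=> i i0; rewrite !mxE (negbTE i0) mulr0 addr0.
  have rlN (s : 'I_r) : (r * L + s < N.+1)%N.
    rewrite NE -mulnA mul2n -addnn ltn_add2l.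
    by apply: leq_trans (ltn_ord s) _; rewrite leq_pmulr.
  (* The image of [g] is a block of [r ^ n.+1] points of the last time layer: the index [r * L] is
     the coordinate 0, so the space coordinates of the block lie between 0 and [1 / L]. *)
  pose g (f : {ffun 'I_n.+1 -> 'I_r}) : {ffun 'I_n.+2 -> 'I_N.+1} :=
    [ffun i => if unlift ord0 i is Some j then Ordinal (rlN (f j)) else ord_max].
  have g_inj : injective g.
    move=> f1 f2 /ffunP fE; apply/ffunP => i; have := fE (lift ord0 i).
    by rewrite !ffunE liftK => /(congr1 val) /= /addnI /val_inj.
  have -> : 2 * c * r%:R ^+ n.+1 = \sum_(k in [set g f | f in [set: {ffun 'I_n.+1 -> 'I_r}]]%SET) 2 * c.
    rewrite sumr_const card_imset// cardsT card_ffun !card_ord -[RHS]mulr_natr natrX.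
    by [].
  rewrite [leLHS]big_mkcond [leRHS]big_mkcond /=; apply: ler_sum => k _.
  case: ifPn => [/imsetP[f _ ->]|_]; last by case: ifP => // _; rewrite mulr_ge0.
  rewrite ffunE unlift_none eqxx; rewrite ler_wpM2l//; apply: phic => i i0.
  rewrite mxE ffunE; case: unliftP i0 => [j ->|->]; last by rewrite eqxx.
  move=> _ /=; apply: le_trans Leps.
  have r0R : 0 < r%:R :> R by rewrite ltr0n.
  have L0R : 0 < L%:R :> R by rewrite ltr0n.
  have -> : -1 + 2 / N.+1%:R * (r * L + f j)%:R = (f j)%:R / r%:R / L%:R :> R.
    by rewrite NN natrD natrM; field; rewrite !lt0r_neq0.
  rewrite ger0_norm; last by rewrite !divr_ge0// ler0n.
  apply: ler_piMl; first by rewrite invr_ge0 ltW.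
  by rewrite ler_pdivrMr// mul1r ler_nat ltnW.
(* The flux grows like [r ^ n.+1] and the error like [r ^ n]; [K] is the value of [r] beyond which
   the inequality fails. *)
pose K := 4 * n.+2%:R * C * (2 * L%:R) ^+ n / (2 * c).
have K0 : 0 <= K by rewrite /K !mulr_ge0 ?exprn_ge0 ?mulr_ge0 ?invr_ge0 ?mulr_ge0// ltW.
have := archi_boundP K0; set r := Num.bound K => Kr.
have r0 : (0 < r)%N by rewrite -(ltr0n R); exact: le_lt_trans Kr.
have := flux _ r0; apply/negP; rewrite -ltNge.
have r0R : 0 < r%:R :> R by rewrite ltr0n.
have -> : 4 * n.+2%:R * C * (2 * r%:R * L%:R) ^+ n = K * (2 * c) * r%:R ^+ n.
  rewrite /K divfK ?mulf_neq0 ?lt0r_neq0// -[RHS]mulrA -exprMn.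
  by congr (_ * _ ^+ _); ring.
rewrite exprS [ltRHS]mulrA ltr_pM2r ?exprn_gt0// [ltRHS]mulrC ltr_pM2r// mulr_gt0//.
Qed.

End DiscreteDivergence.

Section HairyCube.
Variable R : realType.

Lemma box_compact n (B : R) : compact [set x : 'rV[R]_n | box B x].
Proof.
have -> : [set x : 'rV[R]_n | box B x] =
    [set v : 'rV[R]_n | forall i, `[(- B), B]%classic (v ord0 i)].
  apply/seteqP; split => x /= bx i; have := bx i.
    by rewrite /= in_itv /= ler_norml.
  by rewrite /= in_itv /= -ler_norml.
by apply: (@rV_compact R n (fun=> `[(- B), B]%classic)) => _; exact: segment_compact.
Qed.

(** The constraint set is the zero set of a polynomial in a box, hence compact, and the minimum is
    attained. If it is empty any positive bound serves. *)
Lemma polyf_pos_lower n (B : R) (f g : 'rV[R]_n -> R) : polyf f -> polyf g ->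
  (forall x, box B x -> g x = 0 -> 0 < f x) ->
  exists2 d, 0 < d & forall x, box B x -> g x = 0 -> d <= f x.
Proof.
move=> pf pg fpos.
pose K := [set x : 'rV[R]_n | box B x] `&` [set x | g x = 0].
have [[x0 Kx0]|K0] := pselect (K !=set0); last first.
  by exists 1 => // x bx gx; exfalso; apply: K0; exists x.
have cK : compact K.
  apply: compact_closedI; first exact: box_compact.
  apply: (@preimage_closed _ _ g [set y | y = 0]); last exact: closed_eq.
  by move=> x _; exact: polyf_continuous.
have cf : {within K, continuous f}.
  by apply: continuous_subspaceT; exact: polyf_continuous.
have [c Kc cmin] := EVT_min_rV (ex_intro _ x0 Kx0) cK cf.
have [bc gc] := set_mem Kc.
exists (f c) => [|x bx gx]; first exact: fpos.
by apply: cmin; exact: mem_set.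
Qed.

Definition tail n (z : 'rV[R]_n.+1) : 'rV[R]_n := \row_i z 0 (lift ord0 i).

(** On the cube, unlike the ball, space-time is again a box, so that the grid estimate of the flux
    applies. *)
Lemma hairy_cube n (v : 'rV[R]_n.+1 -> 'rV[R]_n.+1) : odd n.+1 ->
  (forall i, polyf (fun x => v x 0 i)) ->
  (forall x, box 1 x -> (exists i, `|x 0 i| = 1) ->
     \sum_i x 0 i * v x 0 i = 0 /\ v x != 0) ->
  False.
Proof.
move=> oddn pv vP.
have [w wE] : exists w : 'I_n.+1 -> mpoly n.+2 R,
    forall i z, v (tail z) 0 i = meval (z 0) (w i).
  apply: (@fin_all_exists _ (fun=> mpoly n.+2 R)
    (fun i u => forall z, v (tail z) 0 i = meval (z 0) u)) => i.
  apply: (@polyf_comp _ _ _ (fun x => v x 0 i) (@tail n.+1)) => [|j]; first exact: pv.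
  by apply: polyf_ext (polyf_coord R (lift ord0 j)) => x; rewrite mxE.
pose X (j : 'I_n.+2) := mpolyX R (mnm1 j).
(* The components of the homotopy [H], with variable 0 as the time [t] and the remaining ones as
   [x]. *)
pose p (i : 'I_n.+1) : mpoly n.+2 R := - X ord0 * X (lift ord0 i) + (1 - X ord0 ^+ 2) * w i.
have pE i (z : 'rV[R]_n.+2) : meval (z 0) (p i) =
    - z 0 ord0 * z 0 (lift ord0 i) + (1 - z 0 ord0 ^+ 2) * v (tail z) 0 i.
  by rewrite wE mevalD !mevalM mevalN mevalB rmorphXn /= !mevalXU rmorph1.
have XX i j : mderiv j (X i) = (i == j)%:R.
  rewrite mderivX mnm1E; case: eqP => [->|_]; last by rewrite scale0r.
  by rewrite scale1r (_ : mnm_sub _ _ = mnm0) ?mpolyX0//; apply/mnmP => k; rewrite mnmBE subnn mnm0E.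
(* The product vanishes on the side faces, where [H] has no zero; [d] bounds its squared norm from
   below there. *)
have [d d0 dP] : exists2 d, 0 < d & forall z : 'rV[R]_n.+2, box 1 z ->
    \prod_(i < n.+1) (1 - z 0 (lift ord0 i) ^+ 2) = 0 ->
    d <= \sum_i meval (z 0) (p i) ^+ 2.
  apply: polyf_pos_lower.
  - by apply: polyf_sum => i; apply: polyfX; exact: polyf_meval.
  - exists (\prod_(i < n.+1) (1 - X (lift ord0 i) ^+ 2)) => z.
    rewrite rmorph_prod; apply: eq_bigr => i _.
    by rewrite rmorphB rmorphXn rmorph1 /= mevalXU.
  move=> z bz /eqP/prodf_eq0[i _ /eqP zi].
  have bx : box 1 (tail z) by move=> j; rewrite mxE; exact: bz.
  have xi : `|tail z 0 i| = 1.
    apply/eqP; rewrite -sqrp_eq1// real_normK ?num_real// mxE.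
    by rewrite -subr_eq0 -oppr_eq0 opprB zi.
  have [vx vn0] := vP _ bx (ex_intro _ i xi).
  rewrite lt0r sumr_ge0 ?andbT => [|j _]; last exact: sqr_ge0.
  apply/negP => /eqP H0.
  have H j : meval (z 0) (p j) = 0.
    by apply/eqP; rewrite -sqrf_eq0 (psumr_eq0P _ H0)// => k _; exact: sqr_ge0.
  (* Pairing [H = 0] with [x] removes the tangential term and leaves [- t * |x|^2 = 0]; then [H]
     reduces to [v x]. *)
  have t0 : z 0 ord0 = 0.
    have : \sum_j tail z 0 j * meval (z 0) (p j) = 0.
      by apply: big1 => j _; rewrite H mulr0.
    rewrite (eq_bigr (fun j => - z 0 ord0 * tail z 0 j ^+ 2
        + (1 - z 0 ord0 ^+ 2) * (tail z 0 j * v (tail z) 0 j))) => [|j _]; last first.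
      by rewrite pE [tail z 0 j]mxE; ring.
    rewrite big_split /= -!mulr_sumr vx mulr0 addr0 => /eqP.
    rewrite mulf_eq0 oppr_eq0 => /orP[/eqP//|].
    move=> /eqP H1; have /eqP : tail z 0 i ^+ 2 = 0.
      by rewrite (psumr_eq0P _ H1)// => k _; exact: sqr_ge0.
    by rewrite sqrf_eq0 => /eqP xi0; move: xi; rewrite xi0 normr0 => /eqP; rewrite eq_sym oner_eq0.
  move/eqP: vn0; apply; apply/rowP => j; rewrite [RHS]mxE.
  by have := H j; rewrite pE t0 oppr0 mul0r add0r expr0n subr0 mul1r.
(* The positive part of [Q] is supported where the squared norm of [H] is below [d], hence vanishes
   on the side faces. *)
pose Q : mpoly n.+2 R := mpolyC n.+2 d - \sum_i p i ^+ 2.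
have QE (z : 'rV[R]_n.+2) : meval (z 0) Q = d - \sum_i meval (z 0) (p i) ^+ 2.
  rewrite mevalB mevalC; congr (_ - _); rewrite rmorph_sum.
  by apply: eq_bigr => i _; rewrite rmorphXn.
(* The row 0 is a filler: its cofactors, which are the maximal minors of [DH], do not see it. *)
pose DG : 'M[mpoly n.+2 R]_n.+2 :=
  \matrix_(i, j) if unlift ord0 i is Some k then mderiv j (p k) else 0.
pose cof j := cofactor DG ord0 j.
have cofdiv : \sum_j mderiv j (cof j) = 0.
  apply: (@piola _ _ (fun j => mderiv j : {additive mpoly n.+2 R -> mpoly n.+2 R})
    (fun i => if unlift ord0 i is Some k then p k else 0)).
  - by move=> j x y /=; rewrite mderivM.
  - by move=> i j x /=; rewrite mderiv_comm.
  - by move=> i j i0; rewrite mxE; case: unliftP i0 => // ->; rewrite eqxx.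
(* An off-diagonal entry of [DG *m \adj DG]: the cofactor field is orthogonal to the gradient of
   each component of [H], hence also to that of [Q]. *)
have cofgrad i : \sum_j mderiv j (p i) * cof j = 0.
  have := congr1 (fun A : 'M[mpoly n.+2 R]_n.+2 => A (lift ord0 i) ord0) (mul_mx_adj DG).
  rewrite !mxE /= mulr0n => E; apply: etrans E; apply: eq_bigr => j _.
  by rewrite !mxE liftK.
have cofQ : \sum_j mderiv j Q * cof j = 0.
  have -> : \sum_j mderiv j Q * cof j =
      \sum_i (- (2 * p i)) * \sum_j mderiv j (p i) * cof j.
    under [RHS]eq_bigr do rewrite mulr_sumr.
    rewrite [RHS]exchange_big /=; apply: eq_bigr => j _.
    rewrite mderivB mderivC sub0r [mderiv j _]raddf_sum /= -sumrN mulr_suml.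
    by apply: eq_bigr => i _; rewrite expr2 mderivM; ring.
  by apply: big1 => i _; rewrite cofgrad mulr0.
pose psi (z : 'rV[R]_n.+2) := Num.max (meval (z 0) Q) 0 ^+ 2.
pose F (j : 'I_n.+2) (z : 'rV[R]_n.+2) := psi z * meval (z 0) (cof j).
pose dF (j : 'I_n.+2) (z : 'rV[R]_n.+2) :=
  2 * Num.max (meval (z 0) Q) 0 * meval (z 0) (mderiv j Q) * meval (z 0) (cof j)
  + psi z * meval (z 0) (mderiv j (cof j)).
have [C CP] : exists C : 'I_n.+2 -> R, forall j, 0 <= C j /\
    forall x h, box 1 x -> 0 <= h <= 1 ->
     `|F j (x + h *: delta_mx 0 j) - F j x - h * dF j x| <= C j * h ^+ 2.
  apply: (@fin_all_exists _ (fun=> R) (fun j c => 0 <= c /\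
    forall x h, box 1 x -> 0 <= h <= 1 ->
     `|F j (x + h *: delta_mx 0 j) - F j x - h * dF j x| <= c * h ^+ 2)) => j.
  have [C C0 CP] := taylorM (taylor_sqr_pos (taylor_meval Q ler01))
                      (taylor_meval (cof j) ler01).
  by exists C; split => // x h bx h1; have [] := CP x j h bx h1.
pose phi (z : 'rV[R]_n.+2) := Num.max (d - \sum_i tail z 0 i ^+ 2) 0 ^+ 2.
(* On a time face [H] is [- t x] and its space Jacobian is the scalar matrix [- t]; in odd dimension
   the determinant changes sign between the two faces. *)
have time (z : 'rV[R]_n.+2) : z 0 ord0 ^+ 2 = 1 -> F ord0 z = phi z * (- z 0 ord0) ^+ n.+1.
  move=> z1; rewrite /F /psi /phi QE; congr (Num.max (_ - _) _ ^+ 2 * _).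
    apply: eq_bigr => i _; rewrite pE z1 subrr mul0r addr0 exprMn sqrrN z1 mul1r.
    by rewrite mxE.
  rewrite -cofactor_map_mx /cofactor addn0 expr0 mul1r.
  rewrite [X in \det X](_ : _ = (- z 0 ord0)%:M) ?det_scalar//.
  apply/matrixP => i k; rewrite !mxE liftK raddfD /= !mderivM raddfN /= !XX.
  rewrite mderivB expr2 mderivM !XX -[1]mpolyC1 mderivC.
  rewrite (_ : ord0 == lift ord0 k = false)// (inj_eq lift_inj).
  rewrite !(mevalD, mevalM, mevalN, mevalB, mevalC, mevalXU, rmorph_nat) -expr2 z1 /=.
  by case: eqP => _; rewrite ?mulr1n ?mulr0n; ring.
(* With [|x_i| <= eps <= 1] each square is at most [|x_i|], so the sum of squares is at most
   [d / 2]. *)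
pose eps : R := Num.min 1 (d / (2 * n.+1%:R)).
have n0 : 0 < 2 * n.+1%:R :> R by rewrite mulr_gt0.
apply: (@no_signed_flux R n F dF phi (\sum_j C j) ((d / 2) ^+ 2) eps).
- by apply: sumr_ge0 => j _; have [] := CP j.
- by rewrite exprn_gt0// divr_gt0.
- by rewrite lt_min ltr01 divr_gt0.
- move=> j x h bx h1; have [_ /(_ x h bx h1) le1] := CP j.
  apply: le_trans le1 _; rewrite ler_wpM2r ?sqr_ge0//.
  by rewrite (bigD1 j)//= lerDl sumr_ge0// => k _; have [] := CP k.
- move=> x; rewrite big_split /= -mulr_sumr.
  have -> : \sum_j meval (x 0) (mderiv j (cof j)) = 0.
    by rewrite -(raddf_sum (meval (x 0))) cofdiv raddf0.
  rewrite mulr0 addr0; under eq_bigr do rewrite -mulrA -mevalM.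
  by rewrite -mulr_sumr -(raddf_sum (meval (x 0))) cofQ raddf0 mulr0.
- move=> j x bx; case: (unliftP ord0 j) => [i -> _ xi|->]; last by rewrite eqxx.
  rewrite /F /psi QE max_r ?expr0n ?mul0r//= subr_le0; apply: dP => //.
  apply/eqP/prodf_eq0; exists i => //.
  by rewrite -real_normK ?num_real// xi expr1n subrr.
- move=> x x0; rewrite time x0 ?expr1n// -signr_odd oddn expr1; ring.
- by move=> x x0; rewrite time x0 ?opprK ?expr1n ?mulr1// sqrrN expr1n.
- move=> x y xy; rewrite /phi; congr (Num.max (_ - _) _ ^+ 2).
  by apply: eq_bigr => i _; rewrite !mxE xy.
- by move=> x; exact: sqr_ge0.
- move=> x xe; have d2 : d / 2 <= d - \sum_i tail x 0 i ^+ 2.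
    have : \sum_i tail x 0 i ^+ 2 <= \sum_(i < n.+1) d / (2 * n.+1%:R).
      apply: ler_sum => i _; rewrite mxE -real_normK ?num_real//.
      have := xe (lift ord0 i) isT; rewrite le_min => /andP[x1 x2].
      by apply: le_trans x2; rewrite expr2 ler_piMl.
    have -> : \sum_(i < n.+1) d / (2 * n.+1%:R) = d / 2.
      rewrite sumr_const card_ord -[LHS]mulr_natl.
      by field; rewrite lt0r_neq0// ltr0n.
    move=> le_d; rewrite lerBrDl -lerBrDr; apply: le_trans le_d _.
    by rewrite lerBrDr -splitr.
  have dd : 0 <= d / 2 by rewrite divr_ge0// ltW.
  by rewrite /phi max_l ?(le_trans dd)// !expr2 ler_pM.
Qed.

End HairyCube.

(** * Polynomial splittings of the tangent bundle of a sphere *)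

Section SplittingTheTangentBundle.
Variable R : realType.

Definition nsq n (x : 'rV[R]_n) : R := \sum_i x 0 i ^+ 2.

Lemma nsqE n (x : 'rV[R]_n) : (x *m x^T) 0 0 = nsq x.
Proof. by rewrite mxE; apply: eq_bigr => i _; rewrite mxE expr2. Qed.

Lemma nsq_ge0 n (x : 'rV[R]_n) : 0 <= nsq x.
Proof. by apply: sumr_ge0 => i _; exact: sqr_ge0. Qed.

Lemma nsq_eq0 n (x : 'rV[R]_n) : (nsq x == 0) = (x == 0).
Proof.
apply/eqP/eqP => [x0|->]; last by apply: big1 => i _; rewrite mxE expr0n.
apply/rowP => i; rewrite mxE; apply/eqP; rewrite -sqrf_eq0.
by rewrite (psumr_eq0P _ x0)// => j _; exact: sqr_ge0.
Qed.

Lemma nsq_cube n (x : 'rV[R]_n) : (exists i, `|x 0 i| = 1) -> 1 <= nsq x.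
Proof.
move=> [i xi]; rewrite /nsq (bigD1 i)//= -[x 0 i ^+ 2]real_normK ?num_real// xi.
by rewrite expr1n lerDl sumr_ge0// => j _; exact: sqr_ge0.
Qed.

Lemma polyf_nsq n k (g : 'rV[R]_n -> 'rV[R]_k) :
  (forall i, polyf (fun x => g x 0 i)) -> polyf (fun x => nsq (g x)).
Proof. by move=> pg; apply: polyf_sum => i; apply: polyfX. Qed.

Definition seg n (s t : R) (x : 'rV[R]_n.+1) : 'rV[R]_n.+1 :=
  ((1 - t) * s) *: delta_mx 0 0 + t *: x.

Lemma seg0 n s (x : 'rV[R]_n.+1) : seg s 0 x = s *: delta_mx 0 0.
Proof. by rewrite /seg subr0 mul1r scale0r addr0. Qed.

Lemma seg1 n s (x : 'rV[R]_n.+1) : seg s 1 x = x.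
Proof. by rewrite /seg subrr mul0r !scale0r scale1r add0r. Qed.

(** In the closed half space of the pole the cross term is nonnegative, and [(1 - t)^2 + t^2] is at
    least one half: the segment avoids the origin. *)
Lemma nsq_seg n s t (x : 'rV[R]_n.+1) : s ^+ 2 = 1 -> 0 <= t <= 1 ->
  0 <= s * x 0 0 -> 1 <= nsq x -> 2^-1 <= nsq (seg s t x).
Proof.
move=> s1 /andP[t0 t1] sx x1.
have -> : nsq (seg s t x) =
    (1 - t) ^+ 2 + 2 * t * (1 - t) * (s * x 0 0) + t ^+ 2 * nsq x.
  rewrite /nsq !big_ord_recl !mxE /= mulr1.
  have -> : \sum_(i < n) seg s t x 0 (lift ord0 i) ^+ 2 =
      t ^+ 2 * \sum_(i < n) x 0 (lift ord0 i) ^+ 2.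
    by rewrite mulr_sumr; apply: eq_bigr => i _; rewrite !mxE /= mulr0 add0r exprMn.
  have -> : ((1 - t) * s + t * x 0 0) ^+ 2 =
     (1 - t) ^+ 2 * s ^+ 2 + 2 * t * (1 - t) * (s * x 0 0) + t ^+ 2 * x 0 0 ^+ 2 by ring.
  by rewrite s1; ring.
have u1 : 0 <= 2 * t * (1 - t) * (s * x 0 0) 
  by apply: mulr_ge0 => //; apply: mulr_ge0; [rewrite mulr_ge0|rewrite subr_ge0].
have u2 : t ^+ 2 <= t ^+ 2 * nsq x by rewrite ler_peMr ?sqr_ge0.
have u3 := sqr_ge0 (2 * t - 1).
by move: (nsq x) (s * _) u1 u2 => a b u1 u2; nra.
Qed.

Definition rcons0 n (t : R) (x : 'rV[R]_n) : 'rV[R]_n.+1 :=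
  \row_i (if unlift ord0 i is Some j then x 0 j else t).

(** Regarding [t] as an additional coordinate 0 turns this into a Taylor bound in one direction,
    with a constant uniform in [x]. *)
Lemma lipschitz_seg n (s : R) (f : 'rV[R]_n.+1 -> R) : polyf f ->
  exists2 C, 0 <= C & forall x t h, box 1 x -> 0 <= t <= 1 -> 0 <= h <= 1 ->
    `|f (seg s (t + h) x) - f (seg s t x)| <= C * h.
Proof.
move=> pf.
have [p pE] : polyf (fun z : 'rV[R]_n.+2 => f (seg s (z 0 0) (tail z))).
  apply: polyf_comp => // i.
  apply: (@polyf_ext _ _ (fun z => (1 - z 0 0) * s * (i == ord0)%:R + z 0 0 * z 0 (lift ord0 i))).
    by move=> z; rewrite !mxE /=.
  apply: polyfD.
    apply: polyfM; last exact: polyf_cst.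
    apply: polyfM; last exact: polyf_cst.
    by apply: polyfB; [exact: polyf_cst|exact: polyf_coord].
  by apply: polyfM; exact: polyf_coord.
have [C C0 CP] := taylor_meval p ler01.
exists (2 * C) => [|x t h bx t1 h1]; first by rewrite mulr_ge0.
have fE u : f (seg s u x) = meval ((rcons0 u x) 0) p.
  rewrite -pE mxE unlift_none; congr (f (seg _ _ _)).
  by apply/rowP => i; rewrite !mxE liftK.
have zE : rcons0 (t + h) x = rcons0 t x + h *: delta_mx 0 ord0.
  apply/rowP => i; rewrite !mxE; case: unliftP => [j ->|->] /=.
    by rewrite mulr0 addr0.
  by rewrite mulr1.
have bz : box 1 (rcons0 t x).
  move=> i; rewrite mxE; case: unliftP => [j _|_]; first exact: bx.
  by move/andP: t1 => [t0 t1]; rewrite ger0_norm.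
have [_ c1 c2] := CP _ ord0 h bz h1; rewrite !fE zE.
move/andP: h1 => [h0 h1].
rewrite -[X in `|X|](subrK (h * meval (rcons0 t x 0) (mderiv ord0 p))).
apply: le_trans (ler_normD _ _) _; rewrite (normrM h) (ger0_norm h0).
apply: le_trans (lerD c2 (ler_wpM2l h0 c1)) _.
have : C * h ^+ 2 <= C * h by rewrite ler_wpM2l// expr2 ler_piMl.
by move: (C * _ ^+ 2) => b; rewrite -mulrA [C * h]mulrC; lra.
Qed.

Lemma norm1_mulmx_le n (w : 'rV[R]_n) (A : 'M[R]_n) (c : R) :
  (forall i j, `|A i j| <= c) ->
  \sum_j `|(w *m A) 0 j| <= n%:R * c * \sum_j `|w 0 j|.
Proof.
move=> Ac; have -> : n%:R * c * \sum_j `|w 0 j| = \sum_(j < n) \sum_i `|w 0 i| * c.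
  by rewrite sumr_const card_ord -mulr_suml -[RHS]mulr_natl mulrAC mulrA.
apply: ler_sum => j _; rewrite mxE; apply: le_trans (ler_norm_sum _ _ _) _.
by apply: ler_sum => i _; rewrite normrM ler_wpM2l.
Qed.

(* A nonzero vector of the fibre over the pole s e_0 is carried along the
   segment to x by successive projections onto the fibres; fine steps keep it
   nonzero, and every step is polynomial in x. *)
Lemma polynomial_transport n (s : R) (P : 'rV[R]_n.+1 -> 'M[R]_n.+1) d :
  s ^+ 2 = 1 ->
  (forall i j, polyf (fun x => P x i j)) ->
  (forall x, x != 0 -> P x *m P x = nsq x ^+ d *: P x) ->
  P (s *: delta_mx 0 0) != 0 ->
  exists u : 'rV[R]_n.+1 -> 'rV[R]_n.+1,
    [/\ forall i, polyf (fun x => u x 0 i),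
        forall x, exists w, u x = w *m P x
      & forall x, box 1 x -> (exists i, `|x 0 i| = 1) -> 0 <= s * x 0 0 ->
          u x != 0].
Proof.
move=> s1 pP PP P0.
have [i0 ri0] : exists i, row i (P (s *: delta_mx 0 0)) != 0.
  apply/existsP; apply: contraNT P0; rewrite negb_exists => /forallP r0.
  by apply/eqP/row_matrixP => i; rewrite row0; apply/eqP/negbNE/r0.
pose e := row i0 (P (s *: delta_mx 0 0)).
have [C CP] : exists C : 'I_n.+1 * 'I_n.+1 -> R, forall ij, 0 <= C ij /\
    forall x t h, box 1 x -> 0 <= t <= 1 -> 0 <= h <= 1 ->
    `|P (seg s (t + h) x) ij.1 ij.2 - P (seg s t x) ij.1 ij.2| <= C ij * h.
  apply: (@fin_all_exists _ (fun=> R) (fun ij c => 0 <= c /\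
    forall x t h, box 1 x -> 0 <= t <= 1 -> 0 <= h <= 1 ->
    `|P (seg s (t + h) x) ij.1 ij.2 - P (seg s t x) ij.1 ij.2| <= c * h)) => ij.
  by have [c c0 cP] := lipschitz_seg s (pP ij.1 ij.2); exists c.
pose K := \sum_ij C ij.
have K0 : 0 <= K by apply: sumr_ge0 => ij _; have [] := CP ij.
have KP x t h i j : box 1 x -> 0 <= t <= 1 -> 0 <= h <= 1 ->
    `|(P (seg s t x) - P (seg s (t + h) x)) i j| <= K * h.
  move=> bx t1 h1; rewrite 2!mxE distrC.
  have [_ /(_ x t h bx t1 h1) /= le1] := CP (i, j).
  apply: le_trans le1 _; move/andP: h1 => [h0 _]; rewrite ler_wpM2r//.
  by rewrite /K (bigD1 (i, j))//= lerDl sumr_ge0// => k _; have [] := CP k.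
(* Along the segment [nsq] is at least one half, so [P] scales the vectors of its fibre by at least
   [2^-1 ^+ d]; [N] makes the variation of [P] over one step smaller than this in the l1 norm. *)
pose N := (Num.bound (n.+1%:R * K * 2 ^+ d)).+1.
have N0 : 0 < N%:R :> R by rewrite ltr0n.
have NP : n.+1%:R * (K / N%:R) < 2^-1 ^+ d.
  rewrite mulrA ltr_pdivrMr// exprVn ltr_pdivlMl ?exprn_gt0// mulrC.
  apply: lt_le_trans (archi_boundP _) _; first by rewrite !mulr_ge0// exprn_ge0.
  by rewrite ler_nat.
pose u := fix u j x := if j is j'.+1 then u j' x *m P (seg s (j'.+1%:R / N%:R) x)
                       else e.
exists (u N); split.
- suff pu j : forall i, polyf (fun x => u j x 0 i) by exact: pu.
  elim: j => [|j IHj] i; first exact: polyf_cst.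
  apply: polyf_mulmx => [a b|a b]; first by rewrite ord1; exact: IHj.
  apply: (@polyf_comp _ _ _ (fun y => P y a b)) => // c.
  pose t := j.+1%:R / N%:R : R.
  apply: (@polyf_ext _ _ (fun x => (1 - t) * s * (c == 0)%:R + t * x 0 c)).
    by move=> x; rewrite !mxE.
  by apply: polyfD; [exact: polyf_cst|apply: polyfM; [exact: polyf_cst|exact: polyf_coord]].
- move=> x; exists (u N.-1 x); rewrite /u /= -/u divff ?seg1// lt0r_neq0//.
- move=> x bx xc sx.
  have x1 := nsq_cube xc.
  suff main j : (j <= N)%N -> u j x != 0 /\ exists w, u j x = w *m P (seg s (j%:R / N%:R) x).
    by have [] := main N (leqnn _).
  elim: j => [_|j IHj jN] /=.
    by split=> //; exists (delta_mx 0 i0); rewrite mul0r seg0 -rowE.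
  have [uj0 [w uE]] := IHj (ltnW jN); split; last by exists (u j x).
  have t1 : 0 <= (j%:R / N%:R : R) <= 1.
    by apply/andP; split; rewrite ?divr_ge0 ?ler0n// ler_pdivrMr// mul1r ler_nat ltnW.
  have h1 : 0 <= (N%:R^-1 : R) <= 1.
    by apply/andP; split; rewrite ?invr_ge0 ?ler0n// invf_le1// ler1n.
  have xg := nsq_seg s1 t1 sx x1.
  have g0 : seg s (j%:R / N%:R) x != 0.
    by rewrite -nsq_eq0; apply: lt0r_neq0; apply: lt_le_trans xg; rewrite invr_gt0.
  apply/negP => /eqP uP0.
  (* If the next vector were zero, the scaled current one would equal its image under the difference
     of two consecutive projections, which is too small. *)
  have uj : nsq (seg s (j%:R / N%:R) x) ^+ d *: u j x =
      u j x *m (P (seg s (j%:R / N%:R) x) - P (seg s (j%:R / N%:R + N%:R^-1) x)).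
    have -> : j%:R / N%:R + N%:R^-1 = j.+1%:R / N%:R :> R.
      by rewrite -natr1 mulrDl mul1r.
    by rewrite mulmxBr uP0 subr0 uE -mulmxA PP// scalemxAr.
  have S0 : 0 < \sum_b `|u j x 0 b|.
    rewrite lt0r sumr_ge0// andbT; apply: contraNneq uj0 => S0.
    apply/eqP/rowP => b; rewrite [RHS]mxE; apply/eqP; rewrite -normr_eq0.
    by rewrite (psumr_eq0P _ S0).
  have := norm1_mulmx_le (u j x) (fun a b => KP x (j%:R / N%:R) N%:R^-1 a b bx t1 h1).
  rewrite -uj; apply/negP; rewrite -ltNge.
  rewrite [ltRHS](eq_bigr (fun b => nsq (seg s (j%:R / N%:R) x) ^+ d * `|u j x 0 b|)) => [|b _]; last first.
    by rewrite mxE normrM ger0_norm// exprn_ge0// nsq_ge0.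
  rewrite -mulr_sumr ltr_pM2r//; apply: lt_le_trans NP _.
  by apply: lerXn2r; rewrite ?nnegrE ?invr_ge0 ?nsq_ge0.
Qed.

(** [P x] and [Q x] are projections up to powers of [nsq x], with orthogonal row spaces tangent to
    the sphere. The transported sections do not vanish on opposite closed hemispheres, and by
    orthogonality their sum vanishes only where both do. *)
Lemma no_polynomial_splitting n (P Q : 'rV[R]_n.+1 -> 'M[R]_n.+1) d d' :
  odd n.+1 ->
  (forall i j, polyf (fun x => P x i j)) ->
  (forall i j, polyf (fun x => Q x i j)) ->
  (forall x, x != 0 -> P x *m P x = nsq x ^+ d *: P x) ->
  (forall x, x != 0 -> Q x *m Q x = nsq x ^+ d' *: Q x) ->
  (forall x, x != 0 -> P x *m x^T = 0) ->
  (forall x, x != 0 -> Q x *m x^T = 0) ->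
  (forall x, x != 0 -> P x *m (Q x)^T = 0) ->
  (forall s, s ^+ 2 = 1 -> P (s *: delta_mx 0 0) != 0 /\ Q (s *: delta_mx 0 0) != 0) ->
  False.
Proof.
move=> oddn pP pQ PP QQ Px Qx PQ pole.
have one1 : (1 : R) ^+ 2 = 1 by rewrite expr1n.
have mone1 : (- 1 : R) ^+ 2 = 1 by rewrite sqrrN expr1n.
have [u [pu uP u0]] := polynomial_transport one1 pP PP (pole _ one1).1.
have [w [pw wQ w0]] := polynomial_transport mone1 pQ QQ (pole _ mone1).2.
apply: (@hairy_cube R n (fun x => u x + w x) oddn).
  move=> i; apply: (@polyf_ext _ _ (fun x => u x 0 i + w x 0 i)) => [x|].
    by rewrite mxE.
  exact: polyfD.
move=> x bx xc.
have x0 : x != 0.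
  by rewrite -nsq_eq0; apply: lt0r_neq0; apply: lt_le_trans (nsq_cube xc).
have [a ua] := uP x; have [b wb] := wQ x; split.
  have : ((u x + w x) *m x^T) 0 0 = 0.
    by rewrite mulmxDl ua wb -!mulmxA Px// Qx// !mulmx0 addr0 mxE.
  rewrite mxE => E; apply: etrans E; apply: eq_bigr => i _.
  by rewrite [x^T i 0]mxE mulrC.
have uw : u x *m (w x)^T = 0.
  by rewrite ua wb trmx_mul -mulmxA [P x *m _]mulmxA PQ// mul0mx mulmx0.
apply/negP => /eqP uw0.
have ux : u x == 0.
  rewrite -nsq_eq0 -nsqE; apply/eqP.
  have -> : (u x)^T = (u x + w x)^T - (w x)^T by rewrite raddfD addrK.
  by rewrite uw0 trmx0 sub0r mulmxN uw oppr0 mxE.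
have wx : w x == 0 by rewrite -uw0 (eqP ux) add0r.
have [x00|x00] := lerP 0 (x 0 0).
  by have := u0 x bx xc; rewrite mul1r ux => /(_ x00).
by have := w0 x bx xc; rewrite mulN1r wx oppr_ge0 => /(_ (ltW x00)).
Qed.

End SplittingTheTangentBundle.

(** * Osserman families of matrices, Riemannian signature *)

Section OssermanRiemannian.
Variable R : realType.

Lemma nsqZ n a (x : 'rV[R]_n) : nsq (a *: x) = a ^+ 2 * nsq x.
Proof. by rewrite mulr_sumr; apply: eq_bigr => i _; rewrite mxE exprMn. Qed.

Lemma horner_mx_eigen n k (A : 'M[R]_n.+1) (B : 'M[R]_(n.+1, k)) l (q : {poly R}) :
  A *m B = l *: B -> horner_mx A q *m B = q.[l] *: B.
Proof.
move=> AB; elim/poly_ind: q => [|q c IHq].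
  by rewrite rmorph0 mul0mx horner0 scale0r.
rewrite rmorphD rmorphM /= horner_mx_X horner_mx_C mulmxDl -mulmxA AB.
by rewrite -scalemxAr IHq mul_scalar_mx hornerMXaddC scalerA -scalerDl mulrC.
Qed.

Lemma trmx_horner_mx n (A : 'M[R]_n.+1) (q : {poly R}) :
  (horner_mx A q)^T = horner_mx A^T q.
Proof.
elim/poly_ind: q => [|q c IHq]; first by rewrite !rmorph0 trmx0.
rewrite !rmorphD !rmorphM /= !horner_mx_X !horner_mx_C linearD /= trmx_mul IHq.
rewrite tr_scalar_mx; congr (_ + _).
exact: comm_mx_horner.
Qed.

(** The diagonal entries of [(A *m B)^T *m (A *m B)] are the squared norms of the columns of
    [A *m B]. *)
Lemma sym_sqr_eq0 n k (A : 'M[R]_n) (B : 'M[R]_(n, k)) :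
  A^T = A -> A *m (A *m B) = 0 -> A *m B = 0.
Proof.
move=> At AAB; apply/trmx_inj/row_matrixP => j; rewrite trmx0 row0.
apply/eqP; rewrite -nsq_eq0; apply/eqP.
have : ((A *m B)^T *m (A *m B)) j j = 0.
  by rewrite trmx_mul At -mulmxA AAB mulmx0 mxE.
by rewrite mxE => E; apply: etrans E; apply: eq_bigr => i _; rewrite !mxE expr2.
Qed.

Lemma sym_pow_eq0 n k (A : 'M[R]_n.+1) (B : 'M[R]_(n.+1, k)) j :
  A^T = A -> A ^+ j *m B = 0 -> A *m B = 0.
Proof.
move=> At; elim: j B => [|j IHj] B; first by rewrite expr0 mul1mx => ->; rewrite mulmx0.
by rewrite exprSr -mulmxA => /IHj; exact: sym_sqr_eq0.
Qed.

(** Otherwise moving from [c] a little against [c *m B] would make the form negative. *)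
Lemma psd_kernel n (B : 'M[R]_n) (c : 'rV[R]_n) : B^T = B ->
  (forall z : 'rV[R]_n, 0 <= (z *m B *m z^T) 0 0) -> (c *m B *m c^T) 0 0 = 0 ->
  c *m B = 0.
Proof.
move=> Bt psd c0; apply/eqP; rewrite -nsq_eq0 -nsqE.
set z := c *m B; set a := (z *m z^T) 0 0.
pose b := (z *m B *m z^T) 0 0; have b0 : 0 <= b by exact: psd.
have a0 : 0 <= a by rewrite /a nsqE nsq_ge0.
(* Adding 1 keeps the denominator positive even when [b = 0]; the value of the form is still
   negative unless [a = 0]. *)
pose s := a / (b + 1); have := psd (c - s *: z).
have -> : ((c - s *: z) *m B *m (c - s *: z)^T) 0 0 = s ^+ 2 * b - 2 * s * a.
  have zE : B *m c^T = z^T by rewrite trmx_mul Bt.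
  rewrite mulmxBl linearB /= linearZ /= !mulmxBr !mulmxBl.
  rewrite -/z -!scalemxAl -!scalemxAr -[z *m B *m c^T]mulmxA zE.
  rewrite -[z *m c^T]/(c *m B *m c^T).
  have -> : c *m B *m c^T = 0 by apply/matrixP => i j; rewrite !ord1 c0 mxE.
  have Ea : a = \sum_j z 0 j * z^T j 0 by rewrite /a mxE.
  have Eb : b = \sum_j (z *m B) 0 j * z^T j 0 by rewrite /b mxE.
  by rewrite !mxE -Ea -Eb; ring.
have b1 : 0 < b + 1 by rewrite ltr_wpDl.
have -> : s ^+ 2 * b - 2 * s * a = - (a ^+ 2 * (b + 2) / (b + 1) ^+ 2).
  by rewrite /s; field; rewrite lt0r_neq0.
rewrite oppr_ge0 pmulr_lle0 ?invr_gt0 ?exprn_gt0// pmulr_lle0; last by rewrite ltr_wpDl.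
by move=> a2; rewrite -sqrf_eq0 eq_le a2 sqr_ge0.
Qed.

Lemma polyf_quad n (A : 'M[R]_n) : polyf (fun x : 'rV[R]_n => (x *m A *m x^T) 0 0).
Proof.
have pmul : forall i j : 'I_1, polyf (fun x : 'rV[R]_n => (x *m A *m x^T) i j).
  apply: polyf_mulmx => i j.
    apply: polyf_mulmx => a b; last exact: polyf_cst.
    by rewrite ord1; exact: polyf_coord.
  by apply: polyf_ext (polyf_coord R i) => x; rewrite ord1 mxE.
exact: pmul.
Qed.

Lemma sym_quad_eq0 n (A : 'M[R]_n) : A^T = A ->
  (forall x : 'rV[R]_n, (x *m A *m x^T) 0 0 = 0) -> A = 0.
Proof.
move=> At q0; apply/row_matrixP => i; rewrite row0 rowE.
by apply: psd_kernel => // z; rewrite q0.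
Qed.

(** Rayleigh quotient: at a maximum [c] on the unit sphere with value [l], the form of [l%:M - A] is
    nonnegative and vanishes at [c], so [c] lies in its kernel. *)
Lemma sym_eigen_pos n (A : 'M[R]_n) (y : 'rV[R]_n) : A^T = A ->
  0 < (y *m A *m y^T) 0 0 ->
  exists2 l, l != 0 & exists2 w : 'rV[R]_n, w != 0 & w *m A = l *: w.
Proof.
move=> At qy.
have nsq0 z : 0 < (z *m A *m z^T) 0 0 -> 0 < nsq z.
  rewrite [0 < nsq z]lt0r nsq_ge0 andbT nsq_eq0; apply: contraTneq => ->.
  by rewrite !mul0mx mxE ltxx.
have normalize (z : 'rV[R]_n) : 0 < nsq z ->
    nsq ((Num.sqrt (nsq z))^-1 *: z) = 1 /\
    (z *m A *m z^T) 0 0 = nsq z *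
      (((Num.sqrt (nsq z))^-1 *: z) *m A *m ((Num.sqrt (nsq z))^-1 *: z)^T) 0 0.
  move=> z0; have sz : ((Num.sqrt (nsq z))^-1) ^+ 2 = (nsq z)^-1.
    by rewrite exprVn sqr_sqrtr ?ltW.
  split; first by rewrite nsqZ sz mulVf ?lt0r_neq0.
  rewrite linearZ /= -!scalemxAl -scalemxAr scalerA [X in _ * X]mxE.
  by rewrite -expr2 sz mulrA mulfV ?mul1r// lt0r_neq0.
pose K := [set x : 'rV[R]_n | box 1 x] `&` [set x | nsq x = 1].
have K1 x : nsq x = 1 -> K x.
  move=> x1; split => //= i; rewrite -(@expr_le1 _ 2)// real_normK ?num_real//.
  by rewrite -x1 /nsq (bigD1 i)//= lerDl sumr_ge0// => j _; exact: sqr_ge0.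
have cK : compact K.
  apply: compact_closedI; first exact: box_compact.
  apply: (@preimage_closed _ _ (@nsq R n) [set y | y = 1]); last exact: closed_eq.
  by move=> x _; apply: polyf_continuous; apply: polyf_nsq => i; exact: polyf_coord.
have cf : {within K, continuous (fun x : 'rV[R]_n => (x *m A *m x^T) 0 0)}.
  by apply: continuous_subspaceT; apply: polyf_continuous; exact: polyf_quad.
have [yu yE] := normalize y (nsq0 _ qy).
have [c Kc cmax] := EVT_max_rV (ex_intro _ _ (K1 _ yu)) cK cf.
have [_ /= c1] := set_mem Kc.
set l := (c *m A *m c^T) 0 0 in cmax.
have l0 : 0 < l.
  apply: lt_le_trans (cmax _ (mem_set (K1 _ yu))).
  by have := qy; rewrite yE (pmulr_rgt0 _ (nsq0 _ qy)).
exists l; first by rewrite lt0r_neq0.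
exists c; first by rewrite -nsq_eq0 c1 oner_eq0.
have quadE z : (z *m (l%:M - A) *m z^T) 0 0 = l * nsq z - (z *m A *m z^T) 0 0.
  by rewrite mulmxBr mulmxBl mul_mx_scalar -scalemxAl !mxE -nsqE mxE.
have : c *m (l%:M - A) = 0.
  apply: psd_kernel.
  - by rewrite linearB /= tr_scalar_mx At.
  - move=> z; rewrite quadE subr_ge0.
    have [z0|z0] := eqVneq (nsq z) 0.
      move/eqP: z0; rewrite nsq_eq0 => /eqP ->.
      by rewrite !mul0mx mxE -nsqE mul0mx mxE mulr0.
    have z1 : 0 < nsq z by rewrite lt0r z0 nsq_ge0.
    have [zu ->] := normalize z z1.
    by rewrite mulrC ler_pM2r// cmax//; exact/mem_set/K1.
  - by rewrite quadE c1 mulr1 subrr.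
by rewrite mulmxBr mul_mx_scalar => /eqP; rewrite subr_eq0 => /eqP <-.
Qed.

Lemma sym_eigen n (A : 'M[R]_n) : A^T = A -> A != 0 ->
  exists2 l, l != 0 & exists2 w : 'rV[R]_n, w != 0 & w *m A = l *: w.
Proof.
move=> At A0.
have [x qx] : exists x : 'rV[R]_n, (x *m A *m x^T) 0 0 != 0.
  apply: contrapT => nq; move/eqP: A0; apply; apply: sym_quad_eq0 => // x.
  by apply/eqP; apply: contrapT => /negP qx; apply: nq; exists x.
have [qx0|qx0] := ltP 0 ((x *m A *m x^T) 0 0); first exact: sym_eigen_pos qx0.
have Nq : 0 < (x *m (- A) *m x^T) 0 0.
  by rewrite mulmxN mulNmx mxE oppr_gt0 lt_neqAle qx.
have [|l l0 [w w0 wA]] := sym_eigen_pos _ Nq; first by rewrite linearN /= At.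
exists (- l); first by rewrite oppr_eq0.
by exists w => //; rewrite scaleNr -wA mulmxN opprK.
Qed.
End OssermanRiemannian.

Section OssermanOddDimension.
Variables (R : realType) (n : nat) (A : 'I_n.+1 -> 'I_n.+1 -> 'M[R]_n.+1).

(** A quadratic matrix-valued map, the shape of the Jacobi operator as a function of its vector. *)
Definition qmat (x : 'rV[R]_n.+1) : 'M[R]_n.+1 :=
  \sum_b \sum_c (x 0 b * x 0 c) *: A b c.

Lemma qmatZ a x : qmat (a *: x) = a ^+ 2 *: qmat x.
Proof.
rewrite /qmat scaler_sumr; apply: eq_bigr => b _; rewrite scaler_sumr.
by apply: eq_bigr => c _; rewrite !mxE scalerA; congr (_ *: _); ring.
Qed.

Lemma polyf_qmat i j : polyf (fun x => qmat x i j).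
Proof.
apply: (@polyf_ext _ _ (fun x => \sum_b \sum_c (x 0 b * x 0 c) * A b c i j)).
  move=> x; rewrite /qmat summxE; apply: eq_bigr => b _.
  by rewrite summxE; apply: eq_bigr => c _; rewrite mxE.
apply: polyf_sum => b; apply: polyf_sum => c.
by apply: polyfM (polyf_cst _ _); apply: polyfM; exact: polyf_coord.
Qed.

Lemma polyf_qmatX k i j : polyf (fun x => (qmat x ^+ k) i j).
Proof.
elim: k i j => [|k IHk] i j; first exact: polyf_cst.
apply: (@polyf_ext _ _ (fun x => (qmat x *m qmat x ^+ k) i j)) => [x|].
  by rewrite exprS.
by apply: polyf_mulmx => // a b; exact: polyf_qmat.
Qed.

Hypothesis qmat_sym : forall x, (qmat x)^T = qmat x.
Hypothesis qmat_self : forall x, qmat x *m x^T = 0.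
Hypothesis qmat_tr : forall x, \tr (qmat x) = 0.
Hypothesis osserman : forall x y (q : {poly R}), nsq x = 1 -> nsq y = 1 ->
  horner_mx (qmat x) q = 0 -> horner_mx (qmat y) q = 0.

(** Since annihilating polynomials are shared by all unit vectors, a single polynomial in the
    operator gives the eigenprojection everywhere, and it depends polynomially on the vector. *)
Lemma osserman_odd_flat : (0 < n)%N -> odd n.+1 -> forall x, qmat x = 0.
Proof.
move=> n_gt0 oddn; pose e : 'rV[R]_n.+1 := delta_mx 0 0.
have e1 : nsq e = 1.
  rewrite /nsq (bigD1 ord0)//= big1 ?addr0 => [|i i0]; first by rewrite mxE expr1n.
  by rewrite mxE /= (negbTE i0) expr0n.
have normalize (x : 'rV[R]_n.+1) : x != 0 ->
    exists2 y, nsq y = 1 & x = Num.sqrt (nsq x) *: y.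
  move=> x0; have x1 : 0 < nsq x by rewrite lt0r nsq_eq0 x0 nsq_ge0.
  have s0 : Num.sqrt (nsq x) != 0 by rewrite lt0r_neq0// sqrtr_gt0.
  exists ((Num.sqrt (nsq x))^-1 *: x); last by rewrite scalerA mulfV// scale1r.
  by rewrite nsqZ exprVn sqr_sqrtr ?nsq_ge0// mulVf// lt0r_neq0.
have [qe0|qe0] := eqVneq (qmat e) 0.
  move=> x; have [->|x0] := eqVneq x 0.
    by rewrite -(scale0r 0) qmatZ expr0n scale0r.
  have [y y1 ->] := normalize x x0.
  have := @osserman e y 'X e1 y1; rewrite !horner_mx_X qmatZ => ->//.
  exact: scaler0.
have [l l0 [w w0 wl]] := sym_eigen (qmat_sym e) qe0.
(* Removing all factors ['X - l] from the characteristic polynomial and normalising at [l] gives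
   [h], whose value at [qmat y] is the projection onto the [l]-eigenspace. *)
have [k [h0 hl chiE]] := multiplicity_XsubC (char_poly (qmat e)) l.
have {}hl : ~~ root h0 l.
  by move: hl; rewrite monic_neq0// char_poly_monic.
pose h := h0.[l]^-1 *: h0.
have hl1 : h.[l] = 1 by rewrite hornerZ mulVf.
pose H x := horner_mx (qmat x) h.
have lH y : nsq y = 1 -> qmat y *m H y = l *: H y.
  move=> y1; have := @osserman e y (char_poly (qmat e)) e1 y1 (Cayley_Hamilton _).
  rewrite chiE mulrC rmorphM rmorphXn rmorphB /= horner_mx_X horner_mx_C => Hk.
  have : (qmat y - l%:M) *m horner_mx (qmat y) h0 = 0.
    by apply: (@sym_pow_eq0 R n _ _ _ k) => //; rewrite linearB /= qmat_sym tr_scalar_mx.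
  rewrite mulmxBl mul_scalar_mx => /eqP; rewrite subr_eq0 => /eqP lh.
  by rewrite /H horner_mxZ -scalemxAr lh !scalerA mulrC.
have Hid y : nsq y = 1 -> H y *m H y = H y.
  by move=> y1; rewrite {1}/H (horner_mx_eigen _ (lH y y1)) hl1 scale1r.
have Hsym y : (H y)^T = H y by rewrite /H trmx_horner_mx qmat_sym.
have Hself y : nsq y = 1 -> H y *m y^T = 0.
  move=> y1; have y0 : qmat y *m y^T = 0 *: y^T by rewrite qmat_self scale0r.
  have := congr1 (mulmx^~ y^T) (lH y y1); rewrite -mulmxA -scalemxAl.
  rewrite /H (horner_mx_eigen _ y0) -scalemxAr qmat_self scaler0 => /esym/eqP.
  by rewrite scaler_eq0 (negbTE l0) => /eqP.
have H0 y : nsq y = 1 -> H y != 0.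
  move=> y1; apply: contraNneq w0 => Hy0.
  have wlT : qmat e *m w^T = l *: w^T.
    by rewrite -[in LHS](qmat_sym e) -trmx_mul wl linearZ.
  have := horner_mx_eigen h wlT; rewrite hl1 scale1r.
  by rewrite (osserman y1 e1 Hy0) mul0mx => /esym/(congr1 trmx); rewrite trmxK trmx0 => ->.
(* Projection onto the complement of the eigenspace in the tangent space of the sphere at [y]. *)
pose Q y : 'M[R]_n.+1 := 1%:M - H y - y^T *m y.
have yy1 (y : 'rV[R]_n.+1) : nsq y = 1 -> y *m y^T = 1%:M.
  by move=> y1; apply/matrixP => i j; rewrite !ord1 nsqE y1 mxE eqxx.
have yH y : nsq y = 1 -> y *m H y = 0.
  by move=> y1; apply: trmx_inj; rewrite trmx_mul Hsym Hself// trmx0.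
have Qself y : nsq y = 1 -> Q y *m y^T = 0.
  move=> y1; rewrite !mulmxBl Hself// mul1mx subr0 -mulmxA yy1// mulmx1.
  exact: subrr.
have HQ y : nsq y = 1 -> H y *m Q y = 0.
  move=> y1; rewrite !mulmxBr Hid// mulmx1 mulmxA Hself// mul0mx subr0.
  exact: subrr.
have Qsym y : (Q y)^T = Q y.
  by rewrite /Q !linearB /= trmx1 Hsym trmx_mul trmxK.
have Qid y : nsq y = 1 -> Q y *m Q y = Q y.
  move=> y1; rewrite {1}/Q !mulmxBl HQ// mul1mx subr0 -mulmxA.
  have -> : y *m Q y = 0.
    by apply: trmx_inj; rewrite trmx_mul Qsym Qself// trmx0.
  by rewrite mulmx0 subr0.
have Q0 y : nsq y = 1 -> Q y != 0.
  move=> y1; apply/negP => /eqP Qy0.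
  have HE : H y = 1%:M - y^T *m y.
    by move/eqP: Qy0; rewrite /Q addrAC subr_eq0 => /eqP <-.
  (* If the eigenspace filled the tangent space, the trace would be [l * n], which is not zero. *)
  have qE : qmat y = l *: (1%:M - y^T *m y).
    by rewrite -HE -lH// HE mulmxBr mulmx1 mulmxA qmat_self mul0mx subr0.
  have := qmat_tr y; rewrite qE mxtraceZ raddfB /= mxtrace1 mxtrace_mulC yy1//.
  rewrite mxtrace1 -natrB// subn1 /= => /eqP; rewrite mulf_eq0 (negbTE l0) /=.
  by rewrite pnatr_eq0 => /eqP n0; rewrite n0 in n_gt0.
(* Homogenisation: as [qmat] has degree 2, powers of [nsq] bring every term of [P] to degree [2 * D]
   and every term of [P'] to [2 * D.+1]. *)
pose D := size h.
pose P x := \sum_(i < D) (h`_i * nsq x ^+ (D - i)) *: qmat x ^+ i.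
pose P' x := nsq x ^+ D.+1 *: 1%:M - nsq x *: P x - nsq x ^+ D *: (x^T *m x).
have PE (a : R) y : nsq y = 1 -> P (a *: y) = a ^+ 2 ^+ D *: H y.
  move=> y1; rewrite /P /H -[in RHS](coefK h) poly_def rmorph_sum scaler_sumr.
  apply: eq_bigr => i _; rewrite nsqZ y1 mulr1 qmatZ [(_ *: qmat y) ^+ i]exprZn /= horner_mxZ.
  rewrite rmorphXn /= horner_mx_X !scalerA; congr (_ *: _).
  by rewrite mulrAC -mulrA -exprD mulrC addnC subnK// ltnW.
have P'E (a : R) y : nsq y = 1 -> P' (a *: y) = a ^+ 2 ^+ D.+1 *: Q y.
  move=> y1; rewrite /P' PE// nsqZ y1 mulr1 [(a *: y)^T]linearZ /= -scalemxAl -scalemxAr.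
  rewrite /Q !scalerBr; congr (_ - _ - _); rewrite !scalerA; congr (_ *: _).
    by rewrite [RHS]exprS.
  by rewrite [RHS]exprSr [a ^+ 2 in RHS]expr2 !mulrA.
exfalso; apply: (@no_polynomial_splitting R n P P' D D.+1 oddn).
- move=> i j; apply: (@polyf_ext _ _ (fun x =>
    \sum_(k < D) h`_k * nsq x ^+ (D - k) * (qmat x ^+ k) i j)) => [x|].
    by rewrite /P summxE; apply: eq_bigr => k' _; rewrite mxE.
  apply: polyf_sum => k'; apply: polyfM; last exact: polyf_qmatX.
  by apply: polyfM; [exact: polyf_cst|apply/polyfX/polyf_nsq => c; exact: polyf_coord].
- have pn : polyf (@nsq R n.+1) by apply: polyf_nsq => c; exact: polyf_coord.
  move=> i j; apply: (@polyf_ext _ _ (fun x =>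
    nsq x ^+ D.+1 * (1%:M : 'M[R]_n.+1) i j - nsq x *
      (\sum_(k < D) h`_k * nsq x ^+ (D - k) * (qmat x ^+ k) i j)
      - nsq x ^+ D * (x 0 i * x 0 j))) => [x|].
    rewrite /P' /P !mxE big_ord1 !mxE summxE; congr (_ - _ * _ - _).
    by apply: eq_bigr => k' _; rewrite mxE.
  apply: polyfB; last first.
    by apply: polyfM; [exact: polyfX|apply: polyfM; exact: polyf_coord].
  apply: polyfB; first by apply: polyfM; [exact: polyfX|exact: polyf_cst].
  apply: polyfM => //; apply: polyf_sum => k'; apply: polyfM; last exact: polyf_qmatX.
  by apply: polyfM; [exact: polyf_cst|exact: polyfX].
- move=> x x0; have [y y1 xE] := normalize x x0.
  have ax : Num.sqrt (nsq x) ^+ 2 = nsq x by rewrite sqr_sqrtr// nsq_ge0.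
  have -> : P x = nsq x ^+ D *: H y by rewrite {1}xE PE// ax.
  by rewrite -scalemxAl -scalemxAr Hid.
- move=> x x0; have [y y1 xE] := normalize x x0.
  have ax : Num.sqrt (nsq x) ^+ 2 = nsq x by rewrite sqr_sqrtr// nsq_ge0.
  have -> : P' x = nsq x ^+ D.+1 *: Q y by rewrite {1}xE P'E// ax.
  by rewrite -scalemxAl -scalemxAr Qid.
- move=> x x0; have [y y1 ->] := normalize x x0.
  by rewrite PE// linearZ /= -scalemxAl -scalemxAr Hself// !scaler0.
- move=> x x0; have [y y1 ->] := normalize x x0.
  by rewrite P'E// linearZ /= -scalemxAl -scalemxAr Qself// !scaler0.
- move=> x x0; have [y y1 ->] := normalize x x0.
  by rewrite PE// P'E// linearZ /= -scalemxAl -scalemxAr Qsym HQ// !scaler0.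
- move=> s s1; rewrite PE// P'E// s1 !expr1n !scale1r.
  by split; [exact: H0|exact: Q0].
Qed.

End OssermanOddDimension.

(** * Osserman families of matrices, Lorentzian signature *)

Section OssermanLorentzian.
Variable R : realType.

Definition lorentz n : 'M[R]_n :=
  diag_mx (\row_(i < n) (if (i < 1)%N then -1 else 1)).

Lemma lorentzE n (x y : 'rV[R]_n.+1) :
  (x *m lorentz n.+1 *m y^T) 0 0 =
  \sum_i x 0 (lift ord0 i) * y 0 (lift ord0 i) - x 0 0 * y 0 0.
Proof.
rewrite mul_mx_diag mxE big_ord_recl !mxE /= mulrN1 mulNr addrC; congr (_ + _).
by apply: eq_bigr => i _; rewrite !mxE /= mulr1.
Qed.

Lemma lorentz_sqr n : lorentz n *m lorentz n = 1%:M.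
Proof.
rewrite mulmx_diag; apply/matrixP => i j; rewrite !mxE.
by case: ifP => _; rewrite ?mulrNN mulr1.
Qed.

Lemma lorentz_sym n : (lorentz n)^T = lorentz n.
Proof. exact: tr_diag_mx. Qed.

(** Row and column 0 of [C] vanish, so the negative sign of the time axis never enters. *)
Lemma lorentz_trace n (C : 'M[R]_n.+1) : C^T = C -> (forall j, C 0 j = 0) ->
  \tr (C *m lorentz n.+1 *m C *m lorentz n.+1) = \sum_i \sum_j C i j ^+ 2.
Proof.
move=> Ct C0; have C0' i : C i 0 = 0 by rewrite -Ct mxE C0.
have Cji i j : C j i = C i j by rewrite -{1}Ct mxE.
apply: eq_bigr => i _; rewrite !mul_mx_diag mxE mxE big_distrl /=.
apply: eq_bigr => j _; rewrite !mxE Cji.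
case: ifPn => [j0|_]; last case: ifPn => [i0|_].
- have -> : j = 0 by apply/ord_inj/eqP; rewrite -leqn0.
  by rewrite C0 !mul0r expr0n.
- have -> : i = 0 by apply/ord_inj/eqP; rewrite -leqn0.
  by rewrite C0' !mul0r expr0n.
- by rewrite !mulr1 expr2.
Qed.

(* Pi kills the time axis and is the identity on u^perp; since B u = 0, the
   traces tr (B D B D) and tr (C D C D) for C = Pi^T B Pi agree, and the latter
   is a sum of squares. *)
Lemma null_direction n (u : 'rV[R]_n.+1) (B : 'M[R]_n.+1) :
  u 0 0 = 1 -> (u *m lorentz n.+1 *m u^T) 0 0 = 0 ->
  B^T = B -> B *m u^T = 0 ->
  \tr (B *m lorentz n.+1 *m B *m lorentz n.+1) = 0 ->
  forall y : 'rV[R]_n.+1, (y *m lorentz n.+1 *m u^T) 0 0 = 0 ->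
    (y *m B *m y^T) 0 0 = 0.
Proof.
move=> u0 uu Bt Bu trB y yu; set D := lorentz n.+1 in uu trB yu *.
have Dt : D^T = D by exact: lorentz_sym.
have DD : D *m D = 1%:M by exact: lorentz_sqr.
have uB : u *m B = 0 by apply: trmx_inj; rewrite trmx_mul Bt Bu trmx0.
have uu' : u *m D *m u^T = 0 by apply/matrixP => i j; rewrite !ord1 uu mxE.
have yu' : y *m D *m u^T = 0 by apply/matrixP => i j; rewrite !ord1 yu mxE.
pose e : 'rV[R]_n.+1 := delta_mx 0 0.
(* The map called Pi above: on row vectors, [T^T] adds [g(y,u) e] to [y], so it kills [e], as
   [g(e,u) = -1], and fixes the orthogonal of [u]. *)
pose T : 'M[R]_n.+1 := 1%:M + e^T *m (u *m D).
have Tt : T^T = 1%:M + D *m u^T *m e.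
  by rewrite linearD /= trmx1 !trmx_mul trmxK Dt.
pose C := T^T *m B *m T.
have Ct : C^T = C by rewrite /C !trmx_mul trmxK Bt mulmxA.
have eT : e *m T^T = 0.
  have -> : e *m T^T = e + (e *m D *m u^T) *m e by rewrite Tt mulmxDr mulmx1 !mulmxA.
  have -> : e *m D *m u^T = (-1)%:M.
    apply/matrixP => i j; rewrite !ord1 lorentzE u0 mulr1 !mxE /= big1 ?sub0r// => k _.
    by rewrite !mxE mul0r.
  by rewrite mul_scalar_mx scaleN1r subrr.
have C0 j : C 0 j = 0.
  have := congr1 (fun A : 'rV[R]_n.+1 => A 0 j) (rowE 0 C).
  by rewrite mxE => ->; rewrite /C !mulmxA eT !mul0mx mxE.
pose S := D + e^T *m u + u^T *m e.
have TDT : T *m D *m T^T = S.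
  have -> : T *m D = D + e^T *m u.
    by rewrite mulmxDl mul1mx -!mulmxA DD mulmx1.
  rewrite Tt mulmxDr mulmx1 mulmxDl; congr (_ + _).
  have -> : e^T *m u *m (D *m u^T *m e) = e^T *m (u *m D *m u^T) *m e by rewrite !mulmxA.
  by rewrite uu' mulmx0 mul0mx addr0 !mulmxA DD mul1mx.
(* [S] differs from [D] by terms with [u] on one side, which [B] annihilates. *)
have BSB : B *m S *m B = B *m D *m B.
  rewrite /S !mulmxDr !mulmxDl -[B *m (e^T *m u) *m B]mulmxA -[e^T *m u *m B]mulmxA uB.
  by rewrite [B *m (u^T *m e)]mulmxA Bu !mulmx0 !mul0mx !addr0.
have trC : \tr (C *m D *m C *m D) = 0.
  have -> : C *m D *m C *m D = T^T *m (B *m (T *m D *m T^T) *m B *m T *m D).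
    by rewrite /C !mulmxA.
  rewrite mxtrace_mulC TDT.
  have -> : B *m S *m B *m T *m D *m T^T = B *m S *m B *m (T *m D *m T^T) by rewrite !mulmxA.
  rewrite TDT BSB -!mulmxA mxtrace_mulC.
  have -> : D *m (B *m S) *m B = D *m (B *m S *m B) by rewrite !mulmxA.
  by rewrite BSB mxtrace_mulC trB.
have Czero : C = 0.
  move: trC; rewrite lorentz_trace// => s0; apply/matrixP => i j; rewrite [RHS]mxE.
  have /eqP si : \sum_j C i j ^+ 2 = 0.
    by rewrite (psumr_eq0P _ s0)// => k _; apply: sumr_ge0 => l _; exact: sqr_ge0.
  apply/eqP; rewrite -sqrf_eq0; move/eqP: si => si.
  by rewrite (psumr_eq0P _ si)// => k _; exact: sqr_ge0.
have yT : y *m T^T = y.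
  by rewrite Tt mulmxDr mulmx1 !mulmxA yu' mul0mx addr0.
have -> : y *m B *m y^T = y *m C *m y^T.
  by rewrite /C !mulmxA yT -[y *m B *m T *m y^T]mulmxA -[T]trmxK -trmx_mul yT.
by rewrite Czero mulmx0 mul0mx mxE.
Qed.

(** The reflection along [x - e] is an isometry exchanging [e] and [x]. *)
Lemma lorentz_frame n (x : 'rV[R]_n.+1) :
  (x *m lorentz n.+1 *m x^T) 0 0 = -1 ->
  exists L : 'M[R]_n.+1, L *m lorentz n.+1 *m L^T = lorentz n.+1 /\ row 0 L = x.
Proof.
set D := lorentz n.+1 => xx.
have Dt : D^T = D by exact: lorentz_sym.
have DD : D *m D = 1%:M by exact: lorentz_sqr.
pose e : 'rV[R]_n.+1 := delta_mx 0 0.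
have [xe|xe] := eqVneq x e.
  by exists 1%:M; rewrite mul1mx trmx1 mulmx1 rowE mulmx1 xe.
pose v := x - e; pose q := (v *m D *m v^T) 0 0.
have ee (z : 'rV[R]_n.+1) : (e *m D *m z^T) 0 0 = - z 0 0.
  rewrite lorentzE big1 ?sub0r => [|i _]; last by rewrite !mxE mul0r.
  by rewrite mxE !eqxx mul1r.
have ze (z : 'rV[R]_n.+1) : (z *m D *m e^T) 0 0 = - z 0 0.
  rewrite lorentzE big1 ?sub0r => [|i _]; last by rewrite !mxE mulr0.
  by rewrite [e 0 0]mxE !eqxx mulr1.
have qE : q = 2 * (x 0 0 - 1).
  have -> : q = (x *m D *m x^T) 0 0 - (x *m D *m e^T) 0 0
               - ((e *m D *m x^T) 0 0 - (e *m D *m e^T) 0 0).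
    have subE (a b : 'M[R]_1) : (a - b) 0 0 = a 0 0 - b 0 0 by rewrite 2!mxE.
    by rewrite /q /v !mulmxBl linearB /= !mulmxBr !subE.
  by rewrite xx ee ze ee [e 0 0]mxE !eqxx /=; ring.
(* The reflection exists unless [x 0 0 = 1]; then the space part of the unit timelike [x] is zero
   and [x = e], a case already treated. *)
have q0 : q != 0.
  rewrite qE mulf_neq0// subr_eq0; apply: contraNneq xe => x0.
  apply/eqP/rowP => i; rewrite mxE; case: (unliftP ord0 i) => [j ->|->]; last by rewrite x0 eqxx.
  rewrite /=.
  move: xx; rewrite lorentzE x0 mulr1 => /eqP; rewrite subr_eq addNr => /eqP s0.
  apply/eqP; rewrite -sqrf_eq0 expr2.
  by rewrite (psumr_eq0P _ s0)// => k _; rewrite -expr2 sqr_ge0.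
pose k := 2 / q; pose L := 1%:M - k *: (D *m v^T *m v).
exists L; split.
  pose W := D *m v^T *m v *m D.
  have LD : L *m D = D - k *: W by rewrite mulmxBl mul1mx -scalemxAl.
  have Lt : L^T = 1%:M - k *: (v^T *m v *m D).
    by rewrite linearB /= linearZ /= trmx1 !trmx_mul trmxK Dt mulmxA.
  have WW : W *m (v^T *m v *m D) = q *: W.
    have -> : W *m (v^T *m v *m D) = D *m v^T *m (v *m D *m v^T) *m v *m D by rewrite /W !mulmxA.
    by rewrite [v *m D *m v^T]mx11_scalar mul_mx_scalar -!scalemxAl.
  have key : k *: (k *: (q *: W)) = k *: W + k *: W.
    by rewrite !scalerA -scalerDl; congr (_ *: _); rewrite /k; field.
  rewrite LD Lt mulmxBr mulmx1 mulmxBl -!scalemxAr -scalemxAl WW key.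
  by rewrite !mulmxA -/W opprB addrK subrK.
rewrite rowE mulmxBr mulmx1 -scalemxAr !mulmxA.
rewrite -/e [e *m D *m v^T]mx11_scalar ee mul_scalar_mx scalerA.
have -> : k * - v 0 0 = -1.
  rewrite /k qE /v !mxE !eqxx /=; field.
  by apply: contraNneq q0 => x0; rewrite qE x0 mulr0.
by rewrite scaleN1r opprK addrC subrK.
Qed.


Variables (n : nat) (A : 'I_n.+1 -> 'I_n.+1 -> 'M[R]_n.+1).
Local Notation D := (lorentz n.+1).
Local Notation M := (qmat A).

Definition qpol (x y : 'rV[R]_n.+1) : 'M[R]_n.+1 :=
  \sum_b \sum_c (x 0 b * y 0 c + y 0 b * x 0 c) *: A b c.

Lemma qmatD x y (t : R) : M (x + t *: y) = M x + t *: qpol x y + t ^+ 2 *: M y.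
Proof.
rewrite /qmat /qpol !scaler_sumr -!big_split; apply: eq_bigr => b _ /=.
rewrite !scaler_sumr -!big_split; apply: eq_bigr => c _ /=.
by rewrite !mxE !scalerA -!scalerDl; congr (_ *: _); ring.
Qed.

Hypothesis qmat_sym : forall x, (M x)^T = M x.
Hypothesis qmat_self : forall x, M x *m x^T = 0.
Hypothesis qmat_swap : forall x y : 'rV[R]_n.+1,
  (y *m M x *m y^T) 0 0 = (x *m M y *m x^T) 0 0.
Hypothesis qmat_tr : forall x, \tr (M x *m D) = 0.
Hypothesis osserman : forall x y : 'rV[R]_n.+1,
  (x *m D *m x^T) 0 0 = 1 -> (y *m D *m y^T) 0 0 = 1 ->
  \tr (M x *m D *m (M x *m D)) = \tr (M y *m D *m (M y *m D)).

Let e : 'rV[R]_n.+1 := delta_mx 0 0.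

(* Along u + t a the trace is a quartic polynomial in t, equal to
   (2 t + t^2)^2 times a constant for t > 0; so it vanishes at t = 0. *)
Lemma trace_null (a : 'rV[R]_n.+1) : a 0 0 = 0 -> nsq a = 1 ->
  \tr (M (e + a) *m D *m (M (e + a) *m D)) = 0.
Proof.
move=> a0 a1; set u := e + a.
have aa : (a *m D *m a^T) 0 0 = 1.
  rewrite lorentzE a0 mul0r subr0 -a1 /nsq big_ord_recl a0 expr0n add0r.
  by apply: eq_bigr => i _; rewrite expr2.
have xx t : ((u + t *: a) *m D *m (u + t *: a)^T) 0 0 = 2 * t + t ^+ 2.
  rewrite lorentzE !mxE a0 !eqxx /= mulr0 !addr0 mulr1.
  have -> : \sum_i (u + t *: a) 0 (lift ord0 i) * (u + t *: a) 0 (lift ord0 i) =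
      (1 + t) ^+ 2 * nsq a.
    rewrite /nsq big_ord_recl a0 expr0n add0r mulr_sumr; apply: eq_bigr => i _.
    by rewrite !mxE /=; ring.
  by rewrite a1; ring.
pose f t := \tr (M (u + t *: a) *m D *m (M (u + t *: a) *m D)).
pose c := \tr (M a *m D *m (M a *m D)).
have fE t : 0 < t -> f t = (2 * t + t ^+ 2) ^+ 2 * c.
  move=> t0; pose r := Num.sqrt (2 * t + t ^+ 2).
  have g0 : 0 < 2 * t + t ^+ 2 by rewrite addr_gt0 ?mulr_gt0// exprn_gt0.
  have r0 : r != 0 by rewrite lt0r_neq0// sqrtr_gt0.
  have r2 : r ^+ 2 = 2 * t + t ^+ 2 by rewrite sqr_sqrtr// ltW.
  pose y := r^-1 *: (u + t *: a).
  have yy : (y *m D *m y^T) 0 0 = 1.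
    rewrite /y linearZ /= -!scalemxAl -scalemxAr scalerA mxE xx -r2.
    by field.
  have uE : u + t *: a = r *: y by rewrite scalerA mulfV// scale1r.
  rewrite /c -(osserman yy aa) /f uE qmatZ -!scalemxAl -scalemxAr !mxtraceZ -r2.
  by rewrite mulrA -expr2.
pose B0 := M u *m D; pose B1 := qpol u a *m D; pose B2 := M a *m D.
have fP t : f t = \tr (B0 *m B0) + t * (\tr (B0 *m B1) + \tr (B1 *m B0))
    + t ^+ 2 * (\tr (B0 *m B2) + \tr (B1 *m B1) + \tr (B2 *m B0))
    + t ^+ 3 * (\tr (B1 *m B2) + \tr (B2 *m B1)) + t ^+ 4 * \tr (B2 *m B2).
  rewrite /f qmatD !mulmxDl !mulmxDr -!scalemxAl -!scalemxAr -/B0 -/B1 -/B2.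
  by rewrite !raddfD /= !mxtraceZ; ring.
(* Two quartics agreeing at five points coincide; comparing constant coefficients gives the
   claim. *)
have := fE 1 ltr01; have := fE 2 (ltr0Sn R 1); have := fE 3 (ltr0Sn R 2); have := fE 4 (ltr0Sn R 3).
have := fE 5 (ltr0Sn R 4); rewrite !fP -/B0.
move: (\tr (B0 *m B0)) (\tr (B0 *m B1) + _) => t00 t1; lra.
Qed.

(** The null vectors [e + b] and [e - b] both annihilate the form at [z]. Adding the two equations
    removes the mixed term, and the remaining expression is symmetric in [b] and [z] by
    [qmat_swap]. *)
Lemma sectional_spatial (a y : 'rV[R]_n.+1) :
  a 0 0 = 0 -> y 0 0 = 0 -> nsq a = 1 -> nsq y = 1 -> (y *m a^T) 0 0 = 0 ->
  (y *m M e *m y^T) 0 0 = (a *m M e *m a^T) 0 0.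
Proof.
suff main (b z : 'rV[R]_n.+1) : b 0 0 = 0 -> z 0 0 = 0 -> nsq b = 1 ->
    (z *m b^T) 0 0 = 0 -> (z *m M e *m z^T) 0 0 = - (b *m M z *m b^T) 0 0.
  move=> a0 y0 a1 y1 ya; rewrite (main a y)// (main y a)// 1?qmat_swap//.
  have -> : a *m y^T = (y *m a^T)^T by rewrite trmx_mul trmxK.
  by rewrite mxE.
move=> b0 z0 b1 zb.
have null (s : R) : s ^+ 2 = 1 ->
    (z *m M e *m z^T) 0 0 + 2 * s * (e *m M z *m b^T) 0 0 + (b *m M z *m b^T) 0 0 = 0.
  move=> s1; pose u := e + s *: b.
  have sb0 : (s *: b) 0 0 = 0 by rewrite mxE b0 mulr0.
  have sb1 : nsq (s *: b) = 1 by rewrite nsqZ s1 b1 mul1r.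
  have <- : (z *m M u *m z^T) 0 0 =
      (z *m M e *m z^T) 0 0 + 2 * s * (e *m M z *m b^T) 0 0 + (b *m M z *m b^T) 0 0.
    have be : (b *m M z *m e^T) 0 0 = (e *m M z *m b^T) 0 0.
      have -> : b *m M z *m e^T = (e *m M z *m b^T)^T.
        by rewrite !trmx_mul trmxK qmat_sym mulmxA.
      by rewrite mxE.
    rewrite qmat_swap (qmat_swap e z) /u linearD /= linearZ /= !mulmxDl !mulmxDr.
    rewrite -!scalemxAl -!scalemxAr scalerA.
    have addE (p q : 'M[R]_1) : (p + q) 0 0 = p 0 0 + q 0 0 by rewrite mxE.
    have scaleE (k : R) (p : 'M[R]_1) : (k *: p) 0 0 = k * p 0 0 by rewrite mxE.
    by rewrite !addE !scaleE be -expr2 s1; ring.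
  have uu : (u *m D *m u^T) 0 0 = 0.
    rewrite lorentzE /u !mxE b0 !eqxx /= mulr0 addr0 mulr1.
    apply/eqP; rewrite subr_eq0; apply/eqP.
    rewrite -sb1 /nsq big_ord_recl sb0 expr0n add0r.
    by apply: eq_bigr => i _; rewrite !mxE /= add0r expr2.
  apply: (@null_direction n u) => //.
  - by rewrite /u !mxE b0 !eqxx /= mulr0 addr0.
  - by have := trace_null sb0 sb1; rewrite !mulmxA.
  - have zb' : \sum_i z 0 (lift ord0 i) * b 0 (lift ord0 i) = 0.
      move: zb; rewrite mxE big_ord_recl z0 mul0r add0r => E; apply: etrans E.
      by apply: eq_bigr => i _; rewrite [b^T _ _]mxE.
    rewrite lorentzE z0 mul0r subr0; transitivity (s * 0); last exact: mulr0.
    rewrite -[in RHS]zb' mulr_sumr; apply: eq_bigr => i _.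
    by rewrite !mxE /= add0r; ring.
have := null 1 (expr1n _ _); have := null (-1) (etrans (sqrrN _) (expr1n _ _)).
lra.
Qed.

Lemma osserman_lorentz_flat_axis : M e = 0.
Proof.
pose dlt (i : 'I_n.+1) : 'rV[R]_n.+1 := delta_mx 0 i.
have mE (i j : 'I_n.+1) : (dlt i *m M e *m (dlt j)^T) 0 0 = M e i j.
  by rewrite -rowE trmx_delta -colE !mxE.
have mC i j : M e j i = M e i j by rewrite -{1}(qmat_sym e) mxE.
have unit1 (i : 'I_n.+1) : nsq (dlt i) = 1.
  rewrite /nsq (bigD1 i)//= big1 ?addr0 => [|j ji]; first by rewrite mxE !eqxx expr1n.
  by rewrite mxE (negbTE ji) expr0n.
have dot (i j : 'I_n.+1) : (dlt i *m (dlt j)^T) 0 0 = (i == j)%:R.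
  by rewrite -rowE !mxE eq_sym.
have spatial (i : 'I_n.+1) : i != 0 -> dlt i 0 0 = 0.
  by rewrite mxE eq_sym => /negbTE ->.
have diag i j : i != 0 -> j != 0 -> M e i i = M e j j.
  move=> i0 j0; have [->//|ij] := eqVneq i j; rewrite -!mE.
  by apply: sectional_spatial; rewrite ?unit1 ?spatial// dot (negbTE ij).
have off i j : i != 0 -> j != 0 -> i != j -> M e i j = 0.
  (* Comparing the orthonormal pair [(e_i + e_j) / sqrt 2], [(e_i - e_j) / sqrt 2] isolates the
     off-diagonal entry. *)
  move=> i0 j0 ij; pose r : R := (Num.sqrt 2)^-1.
  have r2 : r ^+ 2 = 2^-1 by rewrite exprVn sqr_sqrtr.
  pose a : 'rV[R]_n.+1 := r *: (dlt i + dlt j).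
  pose y : 'rV[R]_n.+1 := r *: (dlt i - dlt j).
  have addE (p q : 'M[R]_1) : (p + q) 0 0 = p 0 0 + q 0 0 by rewrite mxE.
  have scaleE (k : R) (p : 'M[R]_1) : (k *: p) 0 0 = k * p 0 0 by rewrite mxE.
  have form (B : 'M[R]_n.+1) (s t : R) :
      ((r *: (dlt i + s *: dlt j)) *m B *m
       (r *: (dlt i + t *: dlt j))^T) 0 0 =
      2^-1 * (B i i + t * B i j + s * B j i + s * t * B j j).
    have BE (k l : 'I_n.+1) : (dlt k *m B *m (dlt l)^T) 0 0 = B k l.
      by rewrite -rowE trmx_delta -colE !mxE.
    have trE : (r *: (dlt i + t *: dlt j))^T = r *: ((dlt i)^T + t *: (dlt j)^T).
      by apply/matrixP => k l; rewrite !mxE.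
    rewrite trE -!scalemxAl -!scalemxAr !mulmxDl !mulmxDr.
    rewrite -!scalemxAl -!scalemxAr !scaleE !addE !scaleE !BE -r2.
    by ring.
  have aE : a = r *: (dlt i + 1 *: dlt j) by rewrite scale1r.
  have yE : y = r *: (dlt i + (-1) *: dlt j) by rewrite scaleN1r.
  have one (k l : 'I_n.+1) : (1%:M : 'M[R]_n.+1) k l = (k == l)%:R by rewrite mxE.
  have ij' : (j == i) = false by rewrite eq_sym (negbTE ij).
  have time0 s : (r *: (dlt i + s *: dlt j)) 0 0 = 0 :> R.
    by rewrite mxE [X in _ * X]mxE [X in _ + X]mxE !spatial// !mulr0 addr0 mulr0.
  have norm1 s : s ^+ 2 = 1 -> nsq (r *: (dlt i + s *: dlt j)) = 1.
    move=> s1; rewrite -nsqE -[X in X *m _]mulmx1 form !one !eqxx ij' (negbTE ij).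
    by rewrite -expr2 s1 /= !mulr0 !addr0 mul1r mulr1n; field.
  have := @sectional_spatial a y; rewrite aE yE !time0 !norm1 ?expr1n ?sqrrN ?expr1n//.
  rewrite -[X in (X *m (r *: (dlt i + 1 *: _))^T) 0 0]mulmx1 !form !one !eqxx ij' (negbTE ij).
  move=> /(_ erefl erefl erefl erefl) H.
  have {H}/H : 2^-1 * (1%:R + 1 * false%:R + -1 * false%:R + -1 * 1 * 1%:R) = 0 :> R by field.
  rewrite (mC i j) (diag i j i0 j0); lra.
(* The time entry is zero and the space entries are equal, so tracelessness kills them. *)
have diag0 i : i != 0 -> M e i i = 0.
  move=> i0; have := qmat_tr e; rewrite /mxtrace big_ord_recl.
  rewrite mul_mx_diag !mxE /=.
  have -> : M e 0 0 = 0.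
    have := congr1 (fun B : 'cV[R]_n.+1 => B 0 0) (qmat_self e).
    by rewrite trmx_delta -colE !mxE.
  rewrite mul0r add0r (eq_bigr (fun=> M e i i)) => [|j _]; last first.
    by rewrite !mxE /= mulr1; apply: diag.
  rewrite sumr_const card_ord => /eqP; rewrite mulrn_eq0 => /orP[/eqP n0|/eqP//].
  have i_gt0 : (0 < i)%N by rewrite lt0n.
  by exfalso; have := leq_trans i_gt0 (leq_ord i); rewrite n0.
apply/matrixP => i j; rewrite [RHS]mxE.
have row0 k : M e k 0 = 0.
  have := congr1 (fun B : 'cV[R]_n.+1 => B k 0) (qmat_self e).
  by rewrite trmx_delta -colE !mxE.
have [->|i0] := eqVneq i 0; first by rewrite mC row0.
have [->|j0] := eqVneq j 0; first by rewrite row0.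
by have [<-|ij] := eqVneq i j; [exact: diag0|exact: off].
Qed.

End OssermanLorentzian.

(** * Symmetries of the curvature and Weyl tensors *)

Section MixedPartials.
Variables (R : realType) (m : nat).
Local Notation V := 'rV[R]_m.

Lemma is_derive_line (f : V -> R) (x u : V) (s : R) :
  derivable f (x + s *: u) u ->
  is_derive s 1 (fun t : R => f (x + t *: u)) (derive f (x + s *: u) u).
Proof.
move=> df.
have E : (fun h : R => h^-1 *: (((fun t => f (x + t *: u)) \o shift s) (h *: 1)
             - f (x + s *: u))) =
         (fun h : R => h^-1 *: ((f \o shift (x + s *: u)) (h *: u) - f (x + s *: u))).
  apply/funext => h /=; congr (_ *: (f _ - _)).
  by rewrite [h *: 1]mulr1 scalerDl addrCA.
by apply: DeriveDef; rewrite /derivable /derive E.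
Qed.

Lemma mean_value_line (f : V -> R) (x u : V) (h : R) : 0 < h ->
  (forall s, 0 <= s <= h -> derivable f (x + s *: u) u) ->
  exists2 s, 0 <= s <= h & f (x + h *: u) - f x = derive f (x + s *: u) u * h.
Proof.
move=> h0 df.
have d s : 0 <= s <= h -> is_derive s 1 (fun t : R => f (x + t *: u))
    (derive f (x + s *: u) u) by move=> /df; exact: is_derive_line.
have [s||s sh E] := @MVT_segment R (fun t => f (x + t *: u))
    (fun s => derive f (x + s *: u) u) 0 h (ltW h0).
- by rewrite in_itv /= => /andP[s0 sh]; apply: d; rewrite !ltW.
- by apply: derivable_within_continuous => s; rewrite in_itv /= => /d [].
exists s; first by move: sh; rewrite in_itv.
by move: E; rewrite subr0 scale0r addr0.
Qed.

Lemma derive_translate (f : V -> R) (w y u : V) :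
  derivable f (y + w) u -> is_derive y u (fun z => f (z + w)) (derive f (y + w) u).
Proof.
move=> df.
have E : (fun h : R => h^-1 *: (((fun z => f (z + w)) \o shift y) (h *: u) - f (y + w))) =
         (fun h : R => h^-1 *: ((f \o shift (y + w)) (h *: u) - f (y + w))).
  by apply/funext => h /=; rewrite addrA.
by apply: DeriveDef; rewrite /derivable /derive E.
Qed.

(** Mean value theorem twice: in direction [u] for the increment of [f] along [v], then in direction
    [v] for the [u]-derivative. *)
Lemma second_difference (f : V -> R) (x u v : V) (h : R) : 0 < h ->
  (forall s t, 0 <= s <= h -> 0 <= t <= h ->
     derivable f (x + s *: u + t *: v) u /\
     derivable (fun y => derive f y u) (x + s *: u + t *: v) v) ->
  exists s t, [/\ 0 <= s <= h, 0 <= t <= h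
    & f (x + h *: u + h *: v) - f (x + h *: u) - (f (x + h *: v) - f x) =
      derive (fun y => derive f y u) (x + s *: u + t *: v) v * h * h].
Proof.
move=> h0 df; have hh : 0 <= h <= h by apply/andP; split=> //; exact: ltW.
have h00 : 0 <= (0 : R) <= h by apply/andP; split=> //; exact: ltW.
pose phi y := f (y + h *: v) - f y.
have dphi s : 0 <= s <= h -> is_derive (x + s *: u) u phi
    (derive f (x + s *: u + h *: v) u - derive f (x + s *: u) u).
  move=> hs; have [d1 _] := df s h hs hh; have [] := df s 0 hs h00.
  rewrite scale0r addr0 => d0 _.
  have D1 := derive_translate d1; have D0 := derivableP d0.
  exact: is_deriveB.
have [s hs E] : exists2 s, 0 <= s <= h & phi (x + h *: u) - phi x =
    derive phi (x + s *: u) u * h.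
  by apply: mean_value_line => // s /dphi [].
have [t ht E2] : exists2 t, 0 <= t <= h &
    derive f (x + s *: u + h *: v) u - derive f (x + s *: u) u =
    derive (fun y => derive f y u) (x + s *: u + t *: v) v * h.
  by apply: (@mean_value_line (fun y => derive f y u)) => // t /(df s t hs)[].
exists s, t; split => //; rewrite -E2 -(@derive_val _ _ _ _ _ _ _ (dphi s hs)) -E.
by rewrite /phi [x + h *: u + h *: v]addrAC.
Qed.

(** Schwarz's theorem: the second difference is symmetric in [u] and [v], so the two mixed
    derivatives agree at points arbitrarily close to [x], and continuity at [x] concludes. *)
Lemma mixed_partials (U : set V) (f : V -> R) (x u v : V) : open U -> U x ->
  (forall y, U y -> derivable f y u /\ derivable f y v) ->
  (forall y, U y -> derivable (fun z => derive f z u) y v) ->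
  (forall y, U y -> derivable (fun z => derive f z v) y u) ->
  {for x, continuous (fun y => derive (fun z => derive f z u) y v)} ->
  {for x, continuous (fun y => derive (fun z => derive f z v) y u)} ->
  derive (fun z => derive f z u) x v = derive (fun z => derive f z v) x u.
Proof.
move=> oU Ux df duv dvu cuv cvu.
set a := derive _ x v; set b := derive _ x u.
apply: contrapT => /eqP ab; pose eps := `|a - b| / 2.
have eps0 : 0 < eps by rewrite divr_gt0// normr_gt0 subr_eq0.
have nU : \forall y \near x, U y by apply: open_nbhs_nbhs.
have na : \forall y \near x, `|a - derive (fun z => derive f z u) y v| < eps.
  by move/cvgrPdist_lt : cuv => /(_ _ eps0).
have nb : \forall y \near x, `|b - derive (fun z => derive f z v) y u| < eps.
  by move/cvgrPdist_lt : cvu => /(_ _ eps0).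
have /nbhs_ballP[d /= d0 dP] : nbhs x [set y | U y /\
    (`|a - derive (fun z => derive f z u) y v| < eps /\
     `|b - derive (fun z => derive f z v) y u| < eps)].
  exact: filterI nU (filterI na nb).
(* Small enough for the whole parallelogram spanned by [h u] and [h v] to lie in the ball of radius
   [d]. *)
pose h := d / (`|u| + `|v| + 1).
have uv0 : 0 < `|u| + `|v| + 1 by rewrite ltr_wpDl// addr_ge0.
have h0 : 0 < h by rewrite divr_gt0.
have near_x s t : 0 <= s <= h -> 0 <= t <= h -> ball x d (x + s *: u + t *: v).
  move=> /andP[s0 sh] /andP[t0 th]; rewrite -ball_normE /= -addrA opprD addNKr normrN.
  apply: le_lt_trans (ler_normD _ _) _; rewrite !normrZ !ger0_norm//.
  apply: (@le_lt_trans _ _ (h * (`|u| + `|v|))).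
    by rewrite mulrDr lerD// ler_wpM2r.
  by rewrite /h mulrAC ltr_pdivrMr// ltr_pM2l// ltrDl.
have [s [t [hs ht E]]] : exists s t, [/\ 0 <= s <= h, 0 <= t <= h
    & f (x + h *: u + h *: v) - f (x + h *: u) - (f (x + h *: v) - f x) =
      derive (fun y => derive f y u) (x + s *: u + t *: v) v * h * h].
  apply: (@second_difference f x u v h h0) => s t hs ht.
  have [Uy _] := dP _ (near_x s t hs ht); split; [exact: (df _ Uy).1|exact: duv].
have [t' [s' [ht' hs' E']]] : exists s t, [/\ 0 <= s <= h, 0 <= t <= h
    & f (x + h *: v + h *: u) - f (x + h *: v) - (f (x + h *: u) - f x) =
      derive (fun y => derive f y v) (x + s *: v + t *: u) u * h * h].
  apply: (@second_difference f x v u h h0) => s' t' hs' ht'.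
  rewrite addrAC; have [Uy _] := dP _ (near_x t' s' ht' hs').
  by split; [exact: (df _ Uy).2|exact: dvu].
have [_ [na1 _]] := dP _ (near_x s t hs ht).
have [_ [_ nb1]] := dP _ (near_x s' t' hs' ht').
rewrite [x + s' *: u + t' *: v]addrAC in nb1.
have ED : derive (fun y => derive f y u) (x + s *: u + t *: v) v =
          derive (fun y => derive f y v) (x + t' *: v + s' *: u) u.
  apply: (mulIf (lt0r_neq0 h0)); apply: (mulIf (lt0r_neq0 h0)).
  apply: (etrans (esym E)); apply: etrans E'; rewrite [x + h *: v + h *: u]addrAC.
  move: (f (x + h *: u + h *: v)) (f (x + h *: u)) (f (x + h *: v)) (f x) => p q r s0.
  by ring.
have tri (c : R) : `|a - c| < eps -> `|b - c| < eps -> `|a - b| < eps + eps.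
  move=> ac; rewrite distrC => bc; rewrite -(subrKA c).
  exact: le_lt_trans (ler_normD _ _) (ltrD ac bc).
rewrite -ED in nb1; have := tri _ na1 nb1.
by rewrite -splitr ltxx.
Qed.

End MixedPartials.

Section CurvatureSymmetries.
Variables (R : realType) (m : nat).
Local Notation V := 'rV[R]_m.

Lemma derivable_bigD (I : Type) (s : seq I) (P : pred I) (f : I -> V -> R) (x v : V) :
  (forall i, derivable (f i) x v) ->
  is_derive x v (fun y => \sum_(i <- s | P i) f i y)
    (\sum_(i <- s | P i) derive (f i) x v).
Proof.
move=> df; elim: s => [|a s IHs].
  rewrite big_nil; have -> : (fun y : V => \sum_(i <- [::] | P i) f i y) = cst 0.
    by apply/funext => y; rewrite big_nil.
  exact: is_derive_cst.
rewrite big_cons; case Pa : (P a); last first.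
  have -> : (fun y : V => \sum_(i <- a :: s | P i) f i y) =
      (fun y => \sum_(i <- s | P i) f i y).
    by apply/funext => y; rewrite big_cons Pa.
  exact: IHs.
have -> : (fun y : V => \sum_(i <- a :: s | P i) f i y) =
    f a + (fun y => \sum_(i <- s | P i) f i y).
  by apply/funext => y; rewrite big_cons Pa.
by have h1 := derivableP (df a); exact: is_deriveD.
Qed.

Lemma derivable_bigM (I : Type) (s : seq I) (P : pred I) (f : I -> V -> R) (x v : V) :
  (forall i, derivable (f i) x v) ->
  derivable (fun y => \prod_(i <- s | P i) f i y) x v.
Proof.
move=> df; elim: s => [|a s IHs].
  have -> : (fun y : V => \prod_(i <- [::] | P i) f i y) = cst 1.
    by apply/funext => y; rewrite big_nil.
  exact: derivable_cst.
case Pa : (P a); last first.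
  have -> : (fun y : V => \prod_(i <- a :: s | P i) f i y) =
      (fun y => \prod_(i <- s | P i) f i y).
    by apply/funext => y; rewrite big_cons Pa.
  exact: IHs.
have -> : (fun y : V => \prod_(i <- a :: s | P i) f i y) =
    f a * (fun y => \prod_(i <- s | P i) f i y).
  by apply/funext => y; rewrite big_cons Pa.
exact: (derivableM (df a) IHs).
Qed.

Lemma derivable_det n (A : V -> 'M[R]_n) (x v : V) :
  (forall i j, derivable (fun y => A y i j) x v) ->
  derivable (fun y => \det (A y)) x v.
Proof.
move=> dA.
have df (s : 'S_n) : derivable (fun y => (-1) ^+ s * \prod_i A y i (s i)) x v.
  have -> : (fun y : V => (-1) ^+ s * \prod_i A y i (s i)) =
      cst ((-1) ^+ s) * (fun y => \prod_i A y i (s i)) by [].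
  apply: derivableM; first exact: derivable_cst.
  exact: (@derivable_bigM 'I_n (index_enum _) xpredT (fun i y => A y i (s i))).
by have [] := derivable_bigD (index_enum _) xpredT df.
Qed.

(** By Cramer's formula, which describes [invmx] only on invertible matrices; hence the condition
    near [x]. *)
Lemma derivable_invmx n (A : V -> 'M[R]_n) (x v : V) :
  (forall i j, derivable (fun y => A y i j) x v) ->
  (\forall y \near x, A y \in unitmx) ->
  forall i j, derivable (fun y => invmx (A y) i j) x v.
Proof.
move=> dA uA i j.
pose g y := (\det (A y))^-1 * cofactor (A y) j i.
apply: (@near_eq_derivable _ _ _ g).
  near=> y; have uy : A y \in unitmx by near: y.
  by rewrite /g /invmx uy !mxE.
have ux : \det (A x) != 0.
  by have := nbhs_singleton uA; rewrite unitmxE unitfE.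
have -> : g = (fun y => (\det (A y))^-1) * (fun y => cofactor (A y) j i) by [].
apply: derivableM.
  by apply: derivableV => //; exact: derivable_det.
have -> : (fun y => cofactor (A y) j i) =
   cst ((-1) ^+ (j + i)) * (fun y => \det (row' j (col' i (A y)))) by [].
apply: derivableM; first exact: derivable_cst.
apply: derivable_det => k l.
have -> : (fun y => row' j (col' i (A y)) k l) = (fun y => A y (lift j k) (lift i l)).
  by apply/funext => y; rewrite !mxE.
exact: dA.
Unshelve. all: by end_near. Qed.

Lemma sum_delta (f : 'I_m -> R) l : \sum_s f s * (s == l)%:R = f l.
Proof.
rewrite (bigD1 l)//= eqxx mulr1 big1 ?addr0// => s /negbTE ->; exact: mulr0.
Qed.

Variables (G : V -> 'M[R]_m) (U : set V).
Hypothesis oU : open U.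
Hypothesis G_smooth : forall a b, smooth_on U (fun y => G y a b).
Hypothesis G_sym : forall x, U x -> (G x)^T = G x.
Hypothesis G_unit : forall x, U x -> G x \in unitmx.

Let Gsym x a b : U x -> G x a b = G x b a.
Proof. by move=> /G_sym Gt; rewrite -{1}Gt mxE. Qed.

Let near_U x : U x -> \forall y \near x, U y.
Proof. by move=> Ux; apply: open_nbhs_nbhs. Qed.

Let pd_cong i (f g : V -> R) x : U x -> (forall y, U y -> f y = g y) ->
  pd i f x = pd i g x.
Proof.
by move=> Ux fg; apply: near_eq_derive; near=> y; apply: fg; near: y; exact: near_U.
Unshelve. all: by end_near. Qed.

Let dG a b x v : U x -> derivable (fun y => G y a b) x v.
Proof. by move=> Ux; have [H _] := G_smooth a b [::] Ux; exact: H. Qed.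

Let dpdG k a b x v : U x -> derivable (pd k (fun y => G y a b)) x v.
Proof. by move=> Ux; have [H _] := G_smooth a b [:: evec R k] Ux; exact: H. Qed.

Let pdC i j a b x : U x ->
  pd i (pd j (fun y => G y a b)) x = pd j (pd i (fun y => G y a b)) x.
Proof.
move=> Ux; apply: (@mixed_partials _ _ U (fun y => G y a b) x (evec R j) (evec R i)) => //.
- by move=> y Uy; split; exact: dG.
- by move=> y Uy; exact: dpdG.
- by move=> y Uy; exact: dpdG.
- by have [_] := G_smooth a b [:: evec R i; evec R j] Ux.
- by have [_] := G_smooth a b [:: evec R j; evec R i] Ux.
Qed.

(* Christoffel symbols of the first kind; [l] is the lowered index. *)
Definition chr1 (l i j : 'I_m) (y : V) : R :=
  2^-1 * (pd i (fun y => G y j l) y + pd j (fun y => G y i l) y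
          - pd l (fun y => G y i j) y).

Let dchr1 l i j x v : U x -> derivable (chr1 l i j) x v.
Proof.
move=> Ux; have -> : chr1 l i j = cst 2^-1 * (pd i (fun y => G y j l)
    + pd j (fun y => G y i l) - pd l (fun y => G y i j)) by [].
apply: derivableM; first exact: derivable_cst.
by apply: derivableB; [apply: derivableD|]; exact: dpdG.
Qed.

Let pdGC k a b x : U x -> pd k (fun y => G y a b) x = pd k (fun y => G y b a) x.
Proof. by move=> Ux; apply: pd_cong => // y; exact: Gsym. Qed.

Let chr1C l i j y : U y -> chr1 l i j y = chr1 l j i y.
Proof. by move=> Uy; rewrite /chr1 (pdGC l i j Uy) [X in X - _]addrC. Qed.

(** Metric compatibility of the Levi-Civita connection, with lowered indices. *)
Let compat i n l x : U x -> pd i (fun y => G y n l) x = chr1 l i n x + chr1 n i l x.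
Proof.
move=> Ux; rewrite /chr1 (pdGC l i n Ux) (pdGC n i l Ux) (pdGC i l n Ux).
rewrite (pdGC l n i Ux) (pdGC n l i Ux).
by field.
Qed.

Let christoffelE k i j : christoffel G k i j = fun x => \sum_l ginv G x k l * chr1 l i j x.
Proof.
apply/funext => x; rewrite /christoffel mulr_sumr; apply: eq_bigr => l _.
by rewrite mulrCA.
Qed.

Let dchr k i j x v : U x -> derivable (christoffel G k i j) x v.
Proof.
move=> Ux; rewrite christoffelE.
have df l : derivable (fun y => ginv G y k l * chr1 l i j y) x v.
  have -> : (fun y => ginv G y k l * chr1 l i j y) =
    (fun y => ginv G y k l) * chr1 l i j by [].
  apply: derivableM; last exact: dchr1.
  apply: derivable_invmx => [a b|]; first exact: dG.
  by near=> y; apply: G_unit; near: y; exact: near_U.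
by have [] := derivable_bigD (index_enum _) xpredT df.
Unshelve. all: by end_near. Qed.

Let lowered l j k x : U x -> \sum_n christoffel G n j k x * G x n l = chr1 l j k x.
Proof.
move=> Ux.
have E s : \sum_n ginv G x n s * G x n l = (s == l)%:R.
  have := congr1 (fun A : 'M[R]_m => A l s) (mulmxV (G_unit Ux)).
  rewrite [RHS]mxE eq_sym mxE => H; apply: etrans H; apply: eq_bigr => n _.
  by rewrite mulrC (Gsym n l Ux).
transitivity (\sum_s chr1 s j k x * \sum_n ginv G x n s * G x n l).
  rewrite (eq_bigr (fun n => \sum_s ginv G x n s * chr1 s j k x * G x n l)).
    rewrite exchange_big /=; apply: eq_bigr => s _; rewrite mulr_sumr.
    by apply: eq_bigr => n _; rewrite mulrAC mulrC.
  by move=> n _; rewrite christoffelE mulr_suml.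
transitivity (\sum_s chr1 s j k x * (s == l)%:R).
  by apply: eq_bigr => s _; rewrite E.
exact: (sum_delta (fun s => chr1 s j k x)).
Qed.

Definition chr_bracket x (a b c d : 'I_m) : R :=
  \sum_n christoffel G n a b x * chr1 n c d x.

(** The form in which the remaining symmetries become visible: a difference of derivatives of
    first-kind symbols and two quadratic terms. *)
Lemma riem_first_kind x i j k l : U x -> riem G x i j k l =
  pd i (chr1 l j k) x - pd j (chr1 l i k) x
  - chr_bracket x j k i l + chr_bracket x i k j l.
Proof.
move=> Ux.
(* The metric is moved under the derivative, and [compat] rewrites its own derivative; half of the
   result cancels against the quadratic part of [riem13]. *)
have D a b c : \sum_n pd a (christoffel G n b c) x * G x n l =
    pd a (chr1 l b c) x - \sum_n christoffel G n b c x * chr1 l a n x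
    - chr_bracket x b c a l.
  have <- : pd a (fun y => \sum_n christoffel G n b c y * G y n l) x = pd a (chr1 l b c) x.
    by apply: pd_cong => // y; exact: lowered.
  have dCG n : is_derive x (evec R a) (fun y => christoffel G n b c y * G y n l)
     (christoffel G n b c x * pd a (fun y => G y n l) x
      + G x n l * pd a (christoffel G n b c) x).
    have h1 := derivableP (@dchr n b c x (evec R a) Ux).
    have h2 := derivableP (@dG n l x (evec R a) Ux).
    exact: is_deriveM.
  have [_ E] := @derivable_bigD 'I_m (index_enum _) xpredT
    (fun n y => christoffel G n b c y * G y n l) x (evec R a) (fun n => @ex_derive _ _ _ _ _ _ _ (dCG n)).
  rewrite /pd E /chr_bracket -!sumrB; apply: eq_bigr => n _.
  rewrite (@derive_val _ _ _ _ _ _ _ (dCG n)) (compat a n l Ux) /pd; ring.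
have -> : riem G x i j k l =
    \sum_n pd i (christoffel G n j k) x * G x n l
    - \sum_n pd j (christoffel G n i k) x * G x n l
    + \sum_n \sum_s (christoffel G s j k x * christoffel G n i s x -
       christoffel G s i k x * christoffel G n j s x) * G x n l.
  rewrite -sumrB -big_split; apply: eq_bigr => n _.
  by rewrite /riem13 mulrDl mulrBl mulr_suml.
have E : \sum_n \sum_s (christoffel G s j k x * christoffel G n i s x -
     christoffel G s i k x * christoffel G n j s x) * G x n l =
   \sum_s christoffel G s j k x * chr1 l i s x -
   \sum_s christoffel G s i k x * chr1 l j s x.
  rewrite exchange_big -sumrB; apply: eq_bigr => s _.
  rewrite -(lowered l i s Ux) -(lowered l j s Ux) !mulr_sumr -sumrB.
  by apply: eq_bigr => n _; rewrite mulrBl !mulrA.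
apply: etrans (congr2 (fun u v => u + v)
  (congr2 (fun u v => u - v) (D i j k) (D j i k)) E) _.
have fin (a b c d e f : R) : a - c - e - (b - d - f) + (c - d) = a - b - e + f by ring.
exact: fin.
Qed.

Let bracketC x a b c d : U x -> chr_bracket x a b c d = chr_bracket x c d a b.
Proof.
move=> Ux; have giC k l : ginv G x k l = ginv G x l k.
  by rewrite /ginv -[in RHS](G_sym Ux) -trmx_inv [RHS]mxE.
have E a' b' c' d' : chr_bracket x a' b' c' d' =
    \sum_n \sum_s ginv G x n s * chr1 s a' b' x * chr1 n c' d' x.
  by apply: eq_bigr => n _; rewrite christoffelE mulr_suml.
rewrite !E exchange_big /=; apply: eq_bigr => s _; apply: eq_bigr => n _.
by rewrite giC mulrAC.
Qed.

Let bracket_sym x a b c d : U x ->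
  (chr_bracket x a b c d = chr_bracket x b a c d) *
  (chr_bracket x a b c d = chr_bracket x a b d c).
Proof.
move=> Ux; have H a' b' c' d' : chr_bracket x a' b' c' d' = chr_bracket x a' b' d' c'.
  by apply: eq_bigr => n _; rewrite (chr1C n c' d' Ux).
by split=> //; rewrite bracketC// H bracketC.
Qed.

Lemma riem_anti12 x i j k l : riem G x i j k l = - riem G x j i k l.
Proof.
rewrite /riem -sumrN; apply: eq_bigr => n _; rewrite -mulNr /riem13; congr (_ * _).
rewrite opprD opprB -sumrN; congr (_ + _); apply: eq_bigr => s _; ring.
Qed.

(** The part symmetric in [k] and [l] is a commutator of second derivatives of the metric, which
    vanishes by [pdC]. *)
Lemma riem_anti34 x i j k l : U x -> riem G x i j k l = - riem G x i j l k.
Proof.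
move=> Ux; rewrite !riem_first_kind//.
have D a b : pd a (chr1 l b k) x + pd a (chr1 k b l) x =
    pd a (pd b (fun y => G y k l)) x.
  have d1 := derivableP (@dchr1 l b k x (evec R a) Ux).
  have d2 := derivableP (@dchr1 k b l x (evec R a) Ux).
  have <- : pd a (chr1 l b k + chr1 k b l) x = pd a (pd b (fun y => G y k l)) x.
    by apply: pd_cong => // y Uy; rewrite (compat b k l Uy).
  exact/esym/(@derive_val _ _ _ _ _ _ _ (is_deriveD d1 d2)).
have fin (a a' p b b' q e f : R) : a + a' = p -> b + b' = q -> p = q ->
  a - b - e + f = - (a' - b' - f + e) by move=> *; lra.
rewrite (bracketC j l i k Ux) (bracketC i l j k Ux).
exact: (fin _ _ _ _ _ _ _ _ (D i j) (D j i) (pdC i j k l Ux)).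
Qed.

(** Torsion-freeness: the first-kind symbols are symmetric in their last two indices, and all terms
    cancel cyclically. *)
Lemma riem_bianchi x i j k l : U x ->
  riem G x i j k l + riem G x j k i l + riem G x k i j l = 0.
Proof.
move=> Ux; rewrite !riem_first_kind//.
have D a b c : pd a (chr1 l b c) x = pd a (chr1 l c b) x.
  by apply: pd_cong => // y Uy; exact: chr1C.
rewrite (D i k j) (D j i k) (D k j i).
rewrite (bracket_sym k j i l Ux).1 (bracket_sym k i j l Ux).1 (bracket_sym j i k l Ux).1.
have fin (a b c d e f : R) :
  a - b - d + e + (b - c - e + f) + (c - a - f + d) = 0 by ring.
exact: fin.
Qed.

End CurvatureSymmetries.

(** A combination of the four Bianchi identities obtained by rotating the four indices. *)
Lemma pair_symmetry (R : realFieldType) (I : Type) (f : I -> I -> I -> I -> R) :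
  (forall i j k l, f i j k l = - f j i k l) ->
  (forall i j k l, f i j k l = - f i j l k) ->
  (forall i j k l, f i j k l + f j k i l + f k i j l = 0) ->
  forall a b c d, f a b c d = f c d a b.
Proof.
move=> a12 a34 bi a b c d.
have := bi a b c d; have := bi b c d a; have := bi c d a b; have := bi d a b c.
rewrite (a34 b c d a) (a34 c d b a) (a12 d b c a) (a34 b d c a).
rewrite (a34 d a c b) (a12 a c d b) (a34 c a d b) (a34 a b d c).
lra.
Qed.

Lemma sum2_linear (R : realType) m (f1 f2 f3 f4 f5 f6 : 'I_m -> 'I_m -> R)
    (c2 c3 c4 c5 c6 : R) :
  \sum_b \sum_c (f1 b c + c2 * f2 b c + c3 * f3 b c + c4 * f4 b c + c5 * f5 b c
     + c6 * f6 b c) =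
  \sum_b \sum_c f1 b c + c2 * \sum_b \sum_c f2 b c + c3 * \sum_b \sum_c f3 b c
   + c4 * \sum_b \sum_c f4 b c + c5 * \sum_b \sum_c f5 b c
   + c6 * \sum_b \sum_c f6 b c.
Proof.
rewrite !mulr_sumr -!big_split; apply: eq_bigr => b _ /=.
by rewrite !mulr_sumr -!big_split.
Qed.

Section WeylSymmetries.
Variables (R : realType) (m : nat) (G : 'rV[R]_m -> 'M[R]_m) (x : 'rV[R]_m).
Hypothesis m3 : (3 <= m)%N.
Hypothesis G_sym : (G x)^T = G x.
Hypothesis G_unit : G x \in unitmx.
Hypothesis anti12 : forall i j k l, riem G x i j k l = - riem G x j i k l.
Hypothesis anti34 : forall i j k l, riem G x i j k l = - riem G x i j l k.
Hypothesis bianchi : forall i j k l,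
  riem G x i j k l + riem G x j k i l + riem G x k i j l = 0.

Let gC a b : G x a b = G x b a.
Proof. by rewrite -{1}G_sym mxE. Qed.

Let giC a b : ginv G x a b = ginv G x b a.
Proof. by rewrite /ginv -[in RHS]G_sym -trmx_inv [RHS]mxE. Qed.

Let giG a b : \sum_n ginv G x a n * G x n b = (a == b)%:R.
Proof.
have := congr1 (fun A : 'M[R]_m => A a b) (mulVmx G_unit).
by rewrite [RHS]mxE mxE.
Qed.

Let riem_pair := pair_symmetry anti12 anti34 bianchi.

Lemma ricciC a b : ricci G x a b = ricci G x b a.
Proof.
rewrite /ricci exchange_big /=; apply: eq_bigr => j _; apply: eq_bigr => i _.
by rewrite giC riem_pair anti12 anti34 opprK.
Qed.

Lemma weyl_anti12 a b c d : weyl G x a b c d = - weyl G x b a c d.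
Proof.
have fin (k t r p1 g1 g2 p2 p3 g3 g4 p4 : R) :
    - r - k * (p1 * g1 + g2 * p2) + k * (p3 * g3 + g4 * p4) + t * (g2 * g1 - g4 * g3)
    = - (r - k * (p4 * g4 + g3 * p3) + k * (p2 * g2 + g1 * p1) + t * (g3 * g4 - g1 * g2)).
  by ring.
by rewrite /weyl anti12; exact: fin.
Qed.

Lemma weyl_anti34 a b c d : weyl G x a b c d = - weyl G x a b d c.
Proof.
have fin (k t r p1 g1 g2 p2 p3 g3 g4 p4 : R) :
    - r - k * (p1 * g1 + g2 * p2) + k * (p3 * g3 + g4 * p4) + t * (g2 * g1 - g4 * g3)
    = - (r - k * (p3 * g3 + g4 * p4) + k * (p1 * g1 + g2 * p2) + t * (g4 * g3 - g2 * g1)).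
  by ring.
by rewrite /weyl anti34; exact: fin.
Qed.

Lemma weyl_bianchi a b c d :
  weyl G x a b c d + weyl G x b c a d + weyl G x c a b d = 0.
Proof.
rewrite /weyl (gC c a) (gC b a) (gC c b) (ricciC c a) (ricciC b a) (ricciC c b).
have fin (k t r1 r2 r3 pad pbd pcd gad gbd gcd pbc pac pab gbc gac gab : R) :
  r1 + r2 + r3 = 0 ->
  r1 - k * (pad * gbc + gad * pbc) + k * (pac * gbd + gac * pbd)
     + t * (gad * gbc - gac * gbd)
  + (r2 - k * (pbd * gac + gbd * pac) + k * (pab * gcd + gab * pcd)
     + t * (gbd * gac - gab * gcd))
  + (r3 - k * (pcd * gab + gcd * pab) + k * (pbc * gad + gbc * pad)
     + t * (gcd * gab - gbc * gad)) = 0 by move=> r0; rewrite -[RHS]r0; ring.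
apply: fin; exact: bianchi.
Qed.

Lemma weyl_trace a d : \sum_b \sum_c ginv G x b c * weyl G x a b c d = 0.
Proof.
pose k : R := (m%:R - 2)^-1; pose t : R := scal G x / ((m%:R - 1) * (m%:R - 2)).
have giGr (f : 'I_m -> R) e : \sum_b \sum_c ginv G x b c * (f c * G x b e) = f e.
  rewrite exchange_big /= -[RHS]sum_delta; apply: eq_bigr => c _.
  rewrite -giG mulr_sumr; apply: eq_bigr => b _.
  by rewrite giC; ring.
have giGl (f : 'I_m -> R) e : \sum_b \sum_c ginv G x b c * (G x e c * f b) = f e.
  rewrite -[RHS]sum_delta; apply: eq_bigr => b _.
  rewrite -giG mulr_sumr; apply: eq_bigr => c _.
  by rewrite gC; ring.
have trg : \sum_b \sum_c ginv G x b c * G x b c = m%:R.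
  rewrite (eq_bigr (fun=> 1)) ?sumr_const ?card_ord// => b _.
  transitivity ((b == b)%:R : R); last by rewrite eqxx.
  rewrite -giG; apply: eq_bigr => c _.
  by rewrite gC.
(* Six elementary contractions; the coefficients [k] and [t] are such that the multiples of the
   Ricci tensor and of the metric cancel separately. *)
transitivity (\sum_b \sum_c (ginv G x b c * riem G x a b c d
    + (t * G x a d - k * ricci G x a d) * (ginv G x b c * G x b c)
    + (- k * G x a d) * (ginv G x b c * ricci G x b c)
    + k * (ginv G x b c * (ricci G x a c * G x b d))
    + k * (ginv G x b c * (G x a c * ricci G x b d))
    + (- t) * (ginv G x b c * (G x a c * G x b d)))).
  apply: eq_bigr => b _; apply: eq_bigr => c _; rewrite /weyl -/k -/t.
  have fin (p q r1 r2 r3 r4 g1 g2 g3 g4 u v : R) :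
    p * (q - u * (r1 * g1 + g2 * r2) + u * (r3 * g3 + g4 * r4) + v * (g2 * g1 - g4 * g3)) =
    p * q + (v * g2 - u * r1) * (p * g1) + (- u * g2) * (p * r2) + u * (p * (r3 * g3))
    + u * (p * (g4 * r4)) + (- v) * (p * (g4 * g3)) by ring.
  exact: fin.
rewrite sum2_linear trg (giGr (fun c => ricci G x a c)) (giGl (fun b => ricci G x b d)).
rewrite (giGr (fun c => G x a c)) -/(scal G x) -/(ricci G x a d).
have m1 : m%:R - 1 != 0 :> R.
  by rewrite -(natrB _ (ltnW (ltnW m3))) pnatr_eq0 subn_eq0 -ltnNge ltnW.
have m2 : m%:R - 2 != 0 :> R.
  by rewrite -(natrB _ (ltnW m3)) pnatr_eq0 subn_eq0 -ltnNge.
rewrite /t /k; move: (scal G x) (ricci G x a d) (G x a d) => s r g.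
by field; rewrite m1 m2.
Qed.

End WeylSymmetries.

(** * The quadratic family of forms of an algebraic curvature tensor *)

Section WeylTensorForms.
Variables (R : realType) (n : nat).
Local Notation I := 'I_n.+1.
Local Notation V := 'rV[R]_n.+1.

Lemma sum_evec (i : I) (f : I -> R) : \sum_a evec R i 0 a * f a = f i.
Proof.
rewrite -[RHS](sum_delta f); apply: eq_bigr => a _.
by rewrite mxE eqxx mulrC.
Qed.

Lemma antisym_sum (f : I -> I -> R) : (forall a b, f a b = - f b a) ->
  \sum_a \sum_b f a b = 0.
Proof.
move=> fN; have : \sum_a \sum_b f a b = - \sum_a \sum_b f a b.
  rewrite {1}exchange_big -sumrN; apply: eq_bigr => a _; rewrite -sumrN.
  by apply: eq_bigr => b _; rewrite fN.
by move: (\sum_a _) => s; lra.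
Qed.

Lemma sum4_swap (f : I -> I -> I -> I -> R) :
  \sum_a \sum_b \sum_c \sum_d f a b c d = \sum_a \sum_b \sum_c \sum_d f c d a b.
Proof.
have pairE (g : I -> I -> I -> I -> R) : \sum_a \sum_b \sum_c \sum_d g a b c d =
    \sum_p \sum_q g p.1 p.2 q.1 q.2.
  rewrite pair_bigA; apply: eq_bigr => p _.
  by rewrite pair_bigA.
by rewrite pairE exchange_big (pairE (fun a b c d => f c d a b)).
Qed.

Variables (w : I -> I -> I -> I -> R) (gi : 'M[R]_n.+1).
Hypothesis w12 : forall a b c d, w a b c d = - w b a c d.
Hypothesis w34 : forall a b c d, w a b c d = - w a b d c.
Hypothesis wbi : forall a b c d, w a b c d + w b c a d + w c a b d = 0.
Hypothesis wtr : forall a d, \sum_b \sum_c gi b c * w a b c d = 0.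
Hypothesis gi_sym : forall a b, gi a b = gi b a.

Let wpair := pair_symmetry w12 w34 wbi.

Let w1324 a b c d : w a b c d = w b a d c.
Proof. by rewrite w12 w34 opprK. Qed.

(** [qmat wmat X] is the bilinear form [W(y,X,X,z)]: the Jacobi operator before raising an index,
    hence symmetric in every signature. *)
Definition wmat (b c : I) : 'M[R]_n.+1 := \matrix_(k, l) w k b c l.
Local Notation K := (qmat wmat).

Lemma qmat_wmatE X k l : K X k l = \sum_b \sum_c X 0 b * X 0 c * w k b c l.
Proof.
rewrite /qmat summxE; apply: eq_bigr => b _; rewrite summxE.
by apply: eq_bigr => c _; rewrite !mxE.
Qed.

Lemma wmat_sym X : (K X)^T = K X.
Proof.
apply/matrixP => k l; rewrite mxE !qmat_wmatE exchange_big.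
apply: eq_bigr => b _; apply: eq_bigr => c _.
by rewrite wpair w1324 [X 0 c * _]mulrC.
Qed.

(** Contracting the last antisymmetric pair of [w] with two copies of [X] gives zero. *)
Lemma wmat_self X : K X *m X^T = 0.
Proof.
apply/matrixP => k i; rewrite ord1 [RHS]mxE mxE.
rewrite -[RHS](@antisym_sum (fun c l => \sum_b X 0 b * X 0 c * w k b c l * X 0 l)).
  rewrite [RHS]exchange_big; apply: eq_bigr => l _.
  rewrite qmat_wmatE exchange_big mulr_suml; apply: eq_bigr => c _.
  by rewrite mulr_suml; apply: eq_bigr => b _; rewrite [X^T _ _]mxE.
move=> c l; rewrite -sumrN; apply: eq_bigr => b _.
by rewrite w34; ring.
Qed.

Lemma wmat_swap (X Y : V) : (Y *m K X *m Y^T) 0 0 = (X *m K Y *m X^T) 0 0.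
Proof.
have E (X' Y' : V) : (Y' *m K X' *m Y'^T) 0 0 =
  \sum_k \sum_l \sum_b \sum_c Y' 0 k * Y' 0 l * (X' 0 b * X' 0 c) * w k b c l.
  rewrite mxE exchange_big; apply: eq_bigr => l _.
  rewrite [(Y' *m _) 0 l]mxE mulr_suml; apply: eq_bigr => k _.
  rewrite qmat_wmatE mulr_sumr mulr_suml; apply: eq_bigr => b _.
  rewrite mulr_sumr mulr_suml; apply: eq_bigr => c _.
  by rewrite [Y'^T _ _]mxE; ring.
rewrite !E sum4_swap; apply: eq_bigr => k _; apply: eq_bigr => l _.
apply: eq_bigr => b _; apply: eq_bigr => c _.
by rewrite w1324; ring.
Qed.

Lemma wmat_trace X : \tr (K X *m gi) = 0.
Proof.
transitivity (\sum_k \sum_l \sum_b \sum_c X 0 b * X 0 c * gi l k * w k b c l).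
  apply: eq_bigr => k _; rewrite mxE; apply: eq_bigr => l _.
  rewrite qmat_wmatE mulr_suml; apply: eq_bigr => b _.
  by rewrite mulr_suml; apply: eq_bigr => c _; rewrite mulrAC.
rewrite sum4_swap big1// => k _; rewrite big1// => l _.
transitivity (X 0 k * X 0 l * \sum_b \sum_c gi b c * w k b c l); last first.
  by rewrite wtr mulr0.
rewrite mulr_sumr; apply: eq_bigr => b _; rewrite mulr_sumr.
by apply: eq_bigr => c _; rewrite gi_sym w1324 mulrA.
Qed.

(** Polarisation makes [w] antisymmetric in its middle indices too, hence totally antisymmetric, and
    the Bianchi identity reads [3 w = 0]. *)
Lemma wmat_eq0 : (forall X, K X = 0) -> forall a b c d, w a b c d = 0.
Proof.
move=> K0.
have w23 a b c d : w a b c d = - w a c b d.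
  have q0 : qpol wmat (evec R b) (evec R c) a d = 0.
    have := qmatD wmat (evec R b) (evec R c) 1.
    by rewrite !K0 add0r scale1r scaler0 addr0 => <-; rewrite mxE.
  apply/eqP; rewrite -addr_eq0 -[X in _ == X]q0; apply/eqP.
  rewrite /qpol summxE -(sum_evec b (fun b => w a b c d)) -(sum_evec c (fun c => w a c b d)).
  rewrite -big_split; apply: eq_bigr => b' _; rewrite summxE /=.
  rewrite -(sum_evec c (fun c => w a b' c d)) -(sum_evec b (fun c => w a b' c d)).
  rewrite !mulr_sumr -big_split; apply: eq_bigr => c' _ /=.
  by rewrite !mxE; ring.
move=> a b c d; have := wbi a b c d.
by rewrite (w23 b c a d) (w12 b a c d) (w12 c a b d) (w23 a c b d) (w12 a b c d); lra.
Qed.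

End WeylTensorForms.

(** * Orthonormal frames *)

Section Frames.
Variables (R : realType) (n : nat).
Local Notation I := 'I_n.+1.
Local Notation V := 'rV[R]_n.+1.
Variables (w : I -> I -> I -> I -> R) (g S D : 'M[R]_n.+1).
Hypothesis D_sqr : D *m D = 1%:M.
Hypothesis frame : S *m g *m S^T = D.

Lemma frame_inverse : g *m (S^T *m D *m S) = 1%:M.
Proof.
have H : S *m (g *m S^T *m D) = 1%:M by rewrite !mulmxA frame D_sqr.
by have := mulmx1C H; rewrite !mulmxA.
Qed.

Lemma frame_unit : S \in unitmx.
Proof.
have H : S *m (g *m S^T *m D) = 1%:M by rewrite !mulmxA frame D_sqr.
by have [] := mulmx1_unit H.
Qed.

Lemma frame_invmx : invmx g = S^T *m D *m S.
Proof.
have [ug _] := mulmx1_unit frame_inverse.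
by rewrite -[RHS](mulKmx ug) frame_inverse mulmx1.
Qed.

(** Components of [w] in the basis formed by the rows of [S], which is orthonormal for [g]. *)
Definition framed (b c : I) : 'M[R]_n.+1 :=
  S *m (\sum_b' \sum_c' (S b b' * S c c') *: wmat w b' c') *m S^T.

Lemma qmat_framed (x : V) : qmat framed x = S *m qmat (wmat w) (x *m S) *m S^T.
Proof.
transitivity (S *m (\sum_b \sum_c (x 0 b * x 0 c) *:
    \sum_b' \sum_c' (S b b' * S c c') *: wmat w b' c') *m S^T).
  rewrite mulmx_sumr mulmx_suml; apply: eq_bigr => b _.
  rewrite mulmx_sumr mulmx_suml; apply: eq_bigr => c _.
  by rewrite /framed -scalemxAr -scalemxAl.
congr (_ *m _ *m _); rewrite /qmat.
transitivity (\sum_b \sum_b' \sum_c \sum_c'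
    (x 0 b * S b b' * (x 0 c * S c c')) *: wmat w b' c').
  apply: eq_bigr => b _; rewrite exchange_big; apply: eq_bigr => c _.
  rewrite scaler_sumr; apply: eq_bigr => b' _; rewrite scaler_sumr.
  by apply: eq_bigr => c' _; rewrite scalerA; congr (_ *: _); ring.
rewrite exchange_big; apply: eq_bigr => b' _.
transitivity (\sum_b \sum_c' \sum_c
    (x 0 b * S b b' * (x 0 c * S c c')) *: wmat w b' c').
  by apply: eq_bigr => b _; rewrite exchange_big.
rewrite exchange_big; apply: eq_bigr => c' _.
rewrite [(x *m S) 0 b']mxE [(x *m S) 0 c']mxE mulr_suml scaler_suml.
by apply: eq_bigr => b _; rewrite mulr_sumr scaler_suml.
Qed.

Hypothesis w12 : forall a b c d, w a b c d = - w b a c d.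
Hypothesis w34 : forall a b c d, w a b c d = - w a b d c.
Hypothesis wbi : forall a b c d, w a b c d + w b c a d + w c a b d = 0.
Hypothesis wtr : forall a d, \sum_b \sum_c invmx g b c * w a b c d = 0.
Hypothesis g_sym : g^T = g.

Lemma framed_sym x : (qmat framed x)^T = qmat framed x.
Proof.
by rewrite qmat_framed !trmx_mul trmxK (wmat_sym w12 w34 wbi) mulmxA.
Qed.

Lemma framed_self x : qmat framed x *m x^T = 0.
Proof.
rewrite qmat_framed -mulmxA -trmx_mul -mulmxA (wmat_self w34).
exact: mulmx0.
Qed.

Lemma framed_swap (x y : V) :
  (y *m qmat framed x *m y^T) 0 0 = (x *m qmat framed y *m x^T) 0 0.
Proof.
have E (x' y' : V) : y' *m qmat framed x' *m y'^T =
    (y' *m S) *m qmat (wmat w) (x' *m S) *m (y' *m S)^T.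
  by rewrite qmat_framed trmx_mul !mulmxA.
by rewrite !E (wmat_swap w12 w34).
Qed.

Lemma framed_trace x : \tr (qmat framed x *m D) = 0.
Proof.
rewrite qmat_framed -!mulmxA mxtrace_mulC -!mulmxA [S^T *m (D *m S)]mulmxA -frame_invmx.
apply: (wmat_trace w12 w34 wtr) => a b.
by rewrite -[in RHS]g_sym -trmx_inv [RHS]mxE.
Qed.

Lemma framed_jacobi x : qmat framed x *m D =
  S *m (qmat (wmat w) (x *m S) *m invmx g) *m invmx S.
Proof.
rewrite qmat_framed frame_invmx !mulmxA.
by rewrite -[RHS]mulmxA mulmxV ?frame_unit// mulmx1.
Qed.

Lemma gform_frame x y : gform g (x *m S) (y *m S) = (x *m D *m y^T) 0 0.
Proof. by rewrite /gform trmx_mul !mulmxA -frame !mulmxA. Qed.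

End Frames.

(** * Vanishing of the Weyl tensor at a point *)

Lemma similar_horner (R : realType) n (A B : 'M[R]_n.+1) (q : {poly R}) :
  Defs.similar A B -> horner_mx A q = 0 -> horner_mx B q = 0.
Proof.
move=> [P [uP ->]] q0; rewrite mxpoly.horner_mx_uconjC// q0.
by rewrite mulmx0 mul0mx.
Qed.

(** The invariant used in the Lorentzian case; the Riemannian case uses annihilating polynomials
    instead. *)
Lemma similar_trace_sqr (R : realType) n (A B : 'M[R]_n.+1) :
  Defs.similar A B -> \tr (A *m A) = \tr (B *m B).
Proof.
move=> [P [uP ->]].
have -> : invmx P *m A *m P *m (invmx P *m A *m P) = invmx P *m (A *m A *m P).
  by rewrite !mulmxA mulmxK.
by rewrite [RHS]mxtrace_mulC mulmxK.
Qed.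

Section Pointwise.
Variables (R : realType) (n : nat).
Local Notation I := 'I_n.+1.
Variables (w : I -> I -> I -> I -> R) (g : 'M[R]_n.+1).
Hypothesis w12 : forall a b c d, w a b c d = - w b a c d.
Hypothesis w34 : forall a b c d, w a b c d = - w a b d c.
Hypothesis wbi : forall a b c d, w a b c d + w b c a d + w c a b d = 0.
Hypothesis wtr : forall a d, \sum_b \sum_c invmx g b c * w a b c d = 0.
Hypothesis g_sym : g^T = g.
Hypothesis osserman : forall X Y, gform g X X = 1 -> gform g Y Y = 1 ->
  Defs.similar (qmat (wmat w) X *m invmx g) (qmat (wmat w) Y *m invmx g).

Lemma riemannian_flat (S : 'M[R]_n.+1) : (0 < n)%N -> odd n.+1 ->
  S *m g *m S^T = 1%:M -> forall X, qmat (wmat w) X = 0.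
Proof.
move=> n0 oddn frame X.
have uS := frame_unit (mulmx1 _) frame.
have flat : forall x, qmat (framed w S) x = 0.
  apply: osserman_odd_flat => //.
  - exact: framed_sym.
  - exact: framed_self.
  - by move=> x; have := framed_trace (mulmx1 _) frame w12 w34 wtr g_sym x; rewrite mulmx1.
  - move=> x y q x1 y1.
    have J z : qmat (framed w S) z =
        S *m (qmat (wmat w) (z *m S) *m invmx g) *m invmx S.
      by have := framed_jacobi w (mulmx1 _) frame z; rewrite mulmx1.
    rewrite !J !mxpoly.horner_mx_uconj// => /(congr1 (fun B => invmx S *m B *m S)).
    rewrite !mulmxA mulVmx// mul1mx mulmxKV// mulmx0 mul0mx => qx.
    rewrite (similar_horner _ qx) ?mulmx0 ?mul0mx//.
    by apply: osserman; rewrite (gform_frame frame) mulmx1 nsqE.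
have := flat (X *m invmx S); rewrite qmat_framed mulmxKV//.
move=> /(congr1 (fun B => invmx S *m B *m invmx S^T)).
by rewrite !mulmxA mulVmx// mul1mx mulmxK ?unitmx_tr// mulmx0 mul0mx.
Qed.

Lemma lorentzian_flat (S : 'M[R]_n.+1) :
  S *m g *m S^T = lorentz R n.+1 -> forall X, qmat (wmat w) X = 0.
Proof.
move=> frame; have DD := lorentz_sqr R n.+1.
(* The flatness along the time axis holds in every orthonormal frame, and [lorentz_frame] makes each
   unit timelike vector the first one of a frame. *)
have axis (T : 'M[R]_n.+1) : T *m g *m T^T = lorentz R n.+1 ->
    qmat (wmat w) (row 0 T) = 0.
  move=> frameT; have uT := frame_unit DD frameT.
  have : qmat (framed w T) (delta_mx 0 0) = 0.
    apply: osserman_lorentz_flat_axis.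
    - exact: framed_sym.
    - exact: framed_self.
    - exact: framed_swap.
    - exact: (framed_trace DD frameT).
    - move=> x y x1 y1; rewrite !(framed_jacobi _ DD frameT).
      have E (B : 'M[R]_n.+1) : \tr (T *m B *m invmx T *m (T *m B *m invmx T)) = \tr (B *m B).
        have -> : T *m B *m invmx T *m (T *m B *m invmx T) = T *m (B *m B *m invmx T).
          by rewrite !mulmxA mulmxKV.
        by rewrite mxtrace_mulC mulmxKV.
      by rewrite !E; apply/similar_trace_sqr/osserman; rewrite (gform_frame frameT).
  rewrite qmat_framed -rowE => /(congr1 (fun B => invmx T *m B *m invmx T^T)).
  by rewrite !mulmxA mulVmx// mul1mx mulmxK ?unitmx_tr// mulmx0 mul0mx.
have timelike x : (x *m lorentz R n.+1 *m x^T) 0 0 = -1 -> qmat (wmat w) (x *m S) = 0.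
  move=> /lorentz_frame[L [LD <-]]; rewrite -row_mul; apply: axis.
  rewrite trmx_mul -LD -frame !mulmxA.
  by [].
have negative x : (x *m lorentz R n.+1 *m x^T) 0 0 < 0 -> qmat (wmat w) (x *m S) = 0.
  move=> x0; pose r := Num.sqrt (- (x *m lorentz R n.+1 *m x^T) 0 0).
  have r0 : r != 0 by rewrite lt0r_neq0// sqrtr_gt0 oppr_gt0.
  have r2 : r ^+ 2 = - (x *m lorentz R n.+1 *m x^T) 0 0 by rewrite sqr_sqrtr// oppr_ge0 ltW.
  have -> : x = r *: (r^-1 *: x) by rewrite scalerA mulfV// scale1r.
  rewrite -scalemxAl qmatZ timelike ?scaler0//.
  rewrite linearZ /= -!scalemxAl -scalemxAr scalerA mxE -[X in _ * X]opprK -r2.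
  by field.
move=> X; pose e : 'rV[R]_n.+1 := delta_mx 0 0.
have uS := frame_unit DD frame; rewrite -(mulmxKV uS X); move: (X *m invmx S) => {X} x.
pose a := (x *m lorentz R n.+1 *m x^T) 0 0; pose b := x 0 0.
have Qt t : ((x + t *: e) *m lorentz R n.+1 *m (x + t *: e)^T) 0 0 = a - 2 * t * b - t ^+ 2.
  have S1 : \sum_i (x + t *: e) 0 (lift ord0 i) * (x + t *: e) 0 (lift ord0 i) =
      \sum_i x 0 (lift ord0 i) * x 0 (lift ord0 i).
    by apply: eq_bigr => i _; rewrite !mxE /= mulr0 addr0.
  have S0 : (x + t *: e) 0 0 = b + t by rewrite !mxE !eqxx /= mulr1.
  by rewrite /a !lorentzE S1 S0 -/b; ring.
(* Moving far enough along the time axis makes any vector timelike: the bound on [t] makes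
   [a - 2 * t * b - t ^+ 2] negative. *)
have zero t : 1 + `|a| + 2 * `|b| <= t -> qmat (wmat w) (x *m S + t *: (e *m S)) = 0.
  move=> ht; rewrite scalemxAl -mulmxDl; apply: negative; rewrite Qt.
  have := ler_norm a; have := ler_norm (- b); rewrite normrN.
  have := normr_ge0 a; have := normr_ge0 b.
  by move: ht; move: `|a| `|b| => p q ht q0 p0 bq ap; nra.
have e0 : qmat (wmat w) (e *m S) = 0.
  apply: timelike; rewrite lorentzE big1 ?sub0r => [|i _]; last by rewrite !mxE mul0r.
  by rewrite !mxE !eqxx mulr1.
pose t := 1 + `|a| + 2 * `|b|.
(* As the form vanishes on the axis itself, it is affine along this line; two zeros make it vanish
   at [x] as well. *)
have z1 := zero t (lexx _); have z2 : qmat (wmat w) (x *m S + (t + 1) *: (e *m S)) = 0.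
  by apply: zero; rewrite lerDl.
have fin (A B : 'M[R]_n.+1) (u : R) : A + u *: B = 0 -> A + (u + 1) *: B = 0 -> A = 0.
  move=> h1; rewrite scalerDl scale1r addrA h1 add0r => B0.
  by move: h1; rewrite B0 scaler0 addr0.
rewrite qmatD e0 scaler0 addr0 in z1; rewrite qmatD e0 scaler0 addr0 in z2.
exact: (fin _ _ t z1 z2).
Qed.

End Pointwise.

Theorem theorem2p2 (R : realType) (m : nat) (M I : Type)
    (A : I -> chart R m M) (p : nat) :
  (3 <= m)%N ->
  pseudo_riemannian A p ->
  ((p = 0%N /\ odd m) \/ p = 1%N) ->
  (conf_spacelike_jordan_osserman A <-> conformally_flat A).
Proof.
case: m A => [//|n] A m3 [_ [_ [opA [_ [smoothA metricA]]]]] sig; split; last first.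
  move=> flat i P iP G x X Y _ _.
  have J0 Z : jacobiW G x Z = 0.
    rewrite /jacobiW (_ : \matrix_(k, l) _ = 0) ?mul0mx//.
    apply/matrixP => k l; rewrite !mxE /weyl4.
    do 4!(apply: big1 => ? _); rewrite flat// mulr0//.
  by exists 1%:M; rewrite unitmx1 !J0 mulmx0 mul0mx.
move=> osserman i P iP; set G := cmetric (A i); set x := cmap (A i) P.
pose U := cmap (A i) @` cdom (A i).
(* The overlap condition for a chart with itself. *)
have oU : open U by have := opA i i; rewrite setIid.
have Ux : U x by exists P.
have symU y : U y -> (G y)^T = G y by move=> [Q iQ <-]; have [] := metricA i Q iQ.
have sqrD : diag_mx (\row_(k < n.+1) (if (k < p)%N then -1 else 1)) *m
    diag_mx (\row_(k < n.+1) (if (k < p)%N then -1 else 1)) = 1%:M :> 'M[R]_n.+1.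
  rewrite mulmx_diag; apply/matrixP => k l; rewrite !mxE.
  by case: ifP => _; rewrite ?mulrNN mulr1.
have unitU y : U y -> G y \in unitmx.
  move=> [Q iQ <-]; have [_ [S [_ frame]]] := metricA i Q iQ.
  by have [] := mulmx1_unit (frame_inverse sqrD frame).
have a12 a b c d : riem G x a b c d = - riem G x b a c d by exact: riem_anti12.
have a34 a b c d : riem G x a b c d = - riem G x a b d c.
  exact: (riem_anti34 oU (smoothA i) symU unitU).
have bi a b c d : riem G x a b c d + riem G x b c a d + riem G x c a b d = 0.
  exact: (riem_bianchi oU (smoothA i) symU unitU).
have gt := symU x Ux; have gu := unitU x Ux.
have w12 := weyl_anti12 a12; have w34 := weyl_anti34 a34.
have wbi := weyl_bianchi gt a12 a34 bi.
have wtr := weyl_trace m3 gt gu.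
(* Summing against the basis vectors [evec k] and [evec l] selects the entries of [wmat]. *)
have JE X : jacobiW G x X = qmat (wmat (weyl G x)) X *m invmx (G x).
  rewrite /jacobiW; congr (_ *m _); apply/matrixP => k l.
  rewrite mxE qmat_wmatE /weyl4.
  transitivity (\sum_a evec R k 0 a *
      \sum_b \sum_c X 0 b * X 0 c * \sum_d evec R l 0 d * weyl G x a b c d).
    apply: eq_bigr => a _; rewrite mulr_sumr; apply: eq_bigr => b _.
    rewrite mulr_sumr; apply: eq_bigr => c _; rewrite !mulr_sumr.
    by apply: eq_bigr => d _; rewrite !mulrA.
  rewrite sum_evec; apply: eq_bigr => b _; apply: eq_bigr => c _.
  by rewrite sum_evec.
have oss X Y : gform (G x) X X = 1 -> gform (G x) Y Y = 1 ->
    Defs.similar (qmat (wmat (weyl G x)) X *m invmx (G x))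
            (qmat (wmat (weyl G x)) Y *m invmx (G x)).
  by rewrite -!JE; exact: osserman.
have [_ [S [_ frame]]] := metricA i P iP.
apply: (wmat_eq0 w12 wbi) => X.
case: sig => [[p0 oddn]|p1].
  apply: (riemannian_flat w12 w34 wbi wtr gt oss (S := S)) => //.
    exact: (ltnW (m3 : (1 < n)%N)).
  rewrite -/G -/x in frame; rewrite frame p0; apply/matrixP => k l.
  by rewrite !mxE.
apply: (lorentzian_flat w12 w34 wbi wtr gt oss (S := S)).
by rewrite frame p1.
Qed.
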